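(* Let $M$ be a closed manifold of dimension $2h+2\geq 4$ and let $(\alpha,\beta)$ be a generalized contact pair of type $(h,0)$ on $M$. Then for all large enough $c\in\mathbb{R}$ the two-form $\omega=d\alpha+c\,\alpha\wedge\beta$ is a locally conformally symplectic form on $M$, and its Lee form $\theta$ equals $c\beta$.
   Context: A generalized contact pair of type $(h,0)$ on a $(2h+2)$-dimensional manifold is a pair $(\alpha,\beta)$ of one-forms such that $d\beta=0$ and $\alpha\wedge(d\alpha)^h\wedge\beta$ is a volume form (nowhere zero); no condition on $(d\alpha)^{h+1}$ is imposed. A locally conformally symplectic (lcs) form is a non-degenerate two-form $\omega$ for which there is a closed one-form $\theta$, called its Lee form, with $d\omega=\omega\wedge\theta$. *)

(* Defs.v *)
From HB Require Import structures.
From mathcomp Require Export all_boot all_order all_algebra all_fingroup.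
From mathcomp Require Export all_classical all_reals all_analysis.
Export numFieldNormedType.Exports.

Set Implicit Arguments.
Unset Strict Implicit.
Unset Printing Implicit Defensive.

Local Open Scope classical_set_scope.
Local Open Scope ring_scope.

Section Smooth.
Context {R : realType} {n : nat} {W : normedModType R}.

(* On an open set [U], [f] is C^(k+1) iff it is differentiable with a C^k
   differential; as 'rV_n is finite dimensional, the latter amounts to all the
   maps x |-> 'd f x v = 'D_v f x being C^k. *)
Fixpoint class_C (k : nat) (U : set 'rV[R]_n) (f : 'rV[R]_n -> W) : Prop :=
  if k is k'.+1 then
    (forall x, U x -> differentiable f x) /\
    (forall v, class_C k' U ('D_v f))
  else forall x, U x -> {for x, continuous f}.

Definition smooth_on (U : set 'rV[R]_n) (f : 'rV[R]_n -> W) : Prop :=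
  forall k, class_C k U f.

End Smooth.

(* A homeomorphism [chart_map] from the open set [cdom] of [T] onto an open set
   of R^n, with inverse [chart_inv]; the values of [chart_map] outside [cdom]
   and of [chart_inv] outside [chart_map @` cdom] are irrelevant. *)
Record chart (R : realType) (n : nat) (T : topologicalType) := Chart {
  cdom : set T;
  chart_map : T -> 'rV[R]_n;
  chart_inv : 'rV[R]_n -> T;
  open_cdom : open cdom;
  open_ccod : open (chart_map @` cdom);
  chartK : forall p, cdom p -> chart_inv (chart_map p) = p;
  chart_continuous : forall p, cdom p -> {for p, continuous chart_map};
  chart_inv_continuous : forall p, cdom p ->
    {for chart_map p, continuous chart_inv}
}.

Definition transition (R : realType) (n : nat) (T : topologicalType)
    (a b : chart R n T) : 'rV[R]_n -> 'rV[R]_n := chart_map b \o chart_inv a.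

Record smooth_manifold (R : realType) (n : nat) := SmoothManifold {
  carrier :> topologicalType;
  carrier_hausdorff : hausdorff_space carrier;
  carrier_second_countable : @second_countable carrier;
  atlas_index : Type;
  atlas : atlas_index -> chart R n carrier;
  atlas_cover : forall p, exists i, cdom (atlas i) p;
  atlas_smooth : forall i j,
    smooth_on (chart_map (atlas i) @` (cdom (atlas i) `&` cdom (atlas j)))
              (transition (atlas i) (atlas j))
}.

(* Charts take values in open subsets of R^n, so there is no boundary. *)
Definition closed_manifold (R : realType) (n : nat) (M : smooth_manifold R n) :
  Prop := compact [set: M].

Section Forms.
Context {R : realType} {n : nat} {M : smooth_manifold R n}.

Local Notation chart_at i := (atlas (s := M) i).

(* Local expressions of a k-form: [w i x V] is the value, at the point with
   coordinates [x] in the i-th chart, on the k tangent vectors whose components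
   in that chart are the rows of [V]. Only the values at x = chart_map p, p in
   the domain of the i-th chart matter. *)
Definition local_form (k : nat) : Type :=
  atlas_index M -> 'rV[R]_n -> 'M[R]_(k, n) -> R.

Definition multilinear_rows (k : nat) (f : 'M[R]_(k, n) -> R) : Prop :=
  forall (A B C : 'M[R]_(k, n)) (r : 'I_k) (b c : R),
    row r A = b *: row r B + c *: row r C ->
    row' r B = row' r A -> row' r C = row' r A ->
    f A = b * f B + c * f C.

Definition alternating_rows (k : nat) (f : 'M[R]_(k, n) -> R) : Prop :=
  forall (A : 'M[R]_(k, n)) (r s : 'I_k),
    r != s -> row r A = row s A -> f A = 0.

(* Smooth differential k-forms on M. In [form_compat], right multiplication by
   the Jacobian of a change of coordinates transforms the components of tangent
   vectors, see [deriveEjacobian]. *)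
Record is_form (k : nat) (w : local_form k) : Prop := IsForm {
  form_multilinear : forall i p, cdom (chart_at i) p ->
    multilinear_rows (w i (chart_map (chart_at i) p));
  form_alternating : forall i p, cdom (chart_at i) p ->
    alternating_rows (w i (chart_map (chart_at i) p));
  form_smooth : forall i V,
    smooth_on (chart_map (chart_at i) @` cdom (chart_at i)) (fun x => w i x V);
  form_compat : forall i j p V,
    cdom (chart_at i) p -> cdom (chart_at j) p ->
    w i (chart_map (chart_at i) p) V =
    w j (chart_map (chart_at j) p)
      (V *m jacobian (transition (chart_at i) (chart_at j))
                     (chart_map (chart_at i) p))
}.

Definition form_eq (k : nat) (w e : local_form k) : Prop :=
  forall i p V, cdom (chart_at i) p ->
    w i (chart_map (chart_at i) p) V = e i (chart_map (chart_at i) p) V.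

Definition form_zero (k : nat) : local_form k := fun _ _ _ => 0.

Definition form_add (k : nat) (w e : local_form k) : local_form k :=
  fun i x V => w i x V + e i x V.

Definition form_scale (k : nat) (c : R) (w : local_form k) : local_form k :=
  fun i x V => c * w i x V.

(* Normalised so that (a /\ b)(u, v) = a(u) b(v) - a(v) b(u) on 1-forms. *)
Definition form_wedge (k l : nat) (w : local_form k) (e : local_form l) :
    local_form (k + l) :=
  fun i x V => (k`! * l`!)%N%:R^-1 *
    \sum_(s : 'S_(k + l)) (-1) ^+ s *
      (w i x (usubmx (row_perm s V)) * e i x (dsubmx (row_perm s V))).

Fixpoint form_pow (k : nat) (w : local_form k) (m : nat) : local_form (m * k) :=
  if m is m'.+1 then form_wedge w (@form_pow k w m') else fun _ _ _ => 1.

(* dw(v_0, .., v_k) = \sum_j (-1)^j D_(v_j) (w(v_0, .., omit v_j, .., v_k)),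
   the v_j having constant components in the chart. *)
Definition ext_d (k : nat) (w : local_form k) : local_form k.+1 :=
  fun i x V => \sum_(j < k.+1)
    (-1) ^+ j * 'D_(row j V) (fun y => w i y (row' j V)) x.

Definition closed_form (k : nat) (w : local_form k) : Prop :=
  form_eq (ext_d w) (@form_zero k.+1).

Definition nowhere_zero (k : nat) (w : local_form k) : Prop :=
  forall i p, cdom (chart_at i) p ->
    exists V, w i (chart_map (chart_at i) p) V != 0.

Definition nondegenerate_form (w : local_form 2) : Prop :=
  forall i p (u : 'rV[R]_n), cdom (chart_at i) p ->
    (forall v : 'rV[R]_n,
       w i (chart_map (chart_at i) p) (col_mx u v : 'M[R]_(1 + 1, n)) = 0) ->
    u = 0.

Definition is_lee_form (w : local_form 2) (t : local_form 1) : Prop :=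
  [/\ is_form t, closed_form t & form_eq (ext_d w) (form_wedge w t)].

Definition lcs_form (w : local_form 2) : Prop :=
  [/\ is_form w, nondegenerate_form w & exists t, is_lee_form w t].

End Forms.

Arguments local_form {R n} M k.
Arguments form_pow {R n M k} w m.

Definition generalized_contact_pair (R : realType) (h : nat)
    (M : smooth_manifold R (2 * h + 2)) (alpha beta : local_form M 1) : Prop :=
  [/\ is_form alpha, is_form beta, closed_form beta &
      nowhere_zero
        (form_wedge (form_wedge alpha (form_pow (ext_d alpha) h)) beta)].

(* Main.v *)
Require Import Defs.
From mathcomp Require Import ring.

(** Write omega for d alpha + c (alpha /\ beta). As beta is closed and d d = 0,
    d omega = c (d alpha /\ beta) = omega /\ c beta, because the summand
    alpha /\ beta of omega is killed by wedging with beta; so c beta is a Lee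
    form of omega whatever c is ([ext_d_omega]). Both d d = 0 and the fact that
    d alpha does not depend on the chart come from the symmetry of second
    derivatives ([class_C_Schwarz]), obtained from the mean value theorem.

    For nondegeneracy, let K be the intersection of the kernels of alpha and
    beta at a point. The volume form alpha /\ (d alpha)^h /\ beta being nonzero
    there means that alpha and beta are independent and that d alpha is
    nondegenerate on K ([contact_independent], [contact_nondegenerate]): if
    either failed, one could choose a basis of the tangent space for which every
    term of the expansion of the volume form vanishes. In terms of the matrix A
    of d alpha and the columns a, b of coefficients of alpha and beta, this says
    that the bordered matrix
<<
         [  A    a   b ]
         [ a^T   0   t ]
         [ b^T  -t   0 ]
>>
    is invertible at t = 0. On the other hand, eliminating the last two
    coordinates for t = 1 / c turns this matrix into
    A + c (a b^T - b a^T), the matrix of omega. The determinant being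
    continuous in the point and in t, omega is nondegenerate at all points near
    a given one as soon as c is large ([near_nondegenerate]), and compactness of
    the manifold makes the bound on c uniform ([large_nondegenerate]).

    The Lee form is unique since wedging 1-forms with a nondegenerate 2-form is
    injective in dimension at least 3 ([wedge_injective]). *)

Set Implicit Arguments.
Unset Strict Implicit.
Unset Printing Implicit Defensive.

Import Order.TTheory GRing.Theory Num.Theory.
Local Open Scope classical_set_scope.
Local Open Scope ring_scope.

(** * Multilinear and alternating functions of the rows of a matrix *)

Section Multilinear.
Context {R : realType} {n : nat}.
Implicit Types (u v w : 'rV[R]_n) (a b c : R).

Definition set_row k (r : 'I_k) v (X : 'M[R]_(k, n)) : 'M[R]_(k, n) :=
  \matrix_i (if i == r then v else row i X).

Lemma set_row_id k (r : 'I_k) (X : 'M[R]_(k, n)) : set_row r (row r X) X = X.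
Proof. by apply/row_matrixP => i; rewrite rowK; case: eqP => // ->. Qed.

Lemma row'_eq k (r : 'I_k) (X Y : 'M[R]_(k, n)) :
  (forall i, i != r -> row i X = row i Y) -> row' r X = row' r Y.
Proof.
move=> e; apply/row_matrixP => i; have := e (lift r i).
rewrite eq_sym neq_lift => /(_ isT) /rowP E.
by apply/rowP => j; have := E j; rewrite !mxE.
Qed.

Lemma multilinear_set_row k (f : 'M[R]_(k, n) -> R) (r : 'I_k) X a b u v :
  multilinear_rows f ->
  f (set_row r (a *: u + b *: v) X) =
    a * f (set_row r u X) + b * f (set_row r v X).
Proof.
move=> fl; apply: (fl _ _ _ r); first by rewrite !rowK eqxx.
- by apply: row'_eq => i /negPf ir; rewrite !rowK ir.
- by apply: row'_eq => i /negPf ir; rewrite !rowK ir.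
Qed.

Lemma multilinear_set_row_sum k (f : 'M[R]_(k, n) -> R) (r : 'I_k) X
    (I : finType) (c : I -> R) (v : I -> 'rV[R]_n) :
  multilinear_rows f ->
  f (set_row r (\sum_i c i *: v i) X) = \sum_i c i * f (set_row r (v i) X).
Proof.
move=> fl; have f0 : f (set_row r 0 X) = 0.
  have := multilinear_set_row r X 0 0 0 0 fl.
  by rewrite !scale0r addr0 !mul0r addr0.
apply: (big_ind2 (fun x y => f (set_row r x X) = y)) => //.
- move=> x y v' z <- <-.
  by have := multilinear_set_row r X 1 1 x v' fl; rewrite !scale1r !mul1r.
- move=> i _; have := multilinear_set_row r X (c i) 0 (v i) 0 fl.
  by rewrite scale0r addr0 mul0r addr0.
Qed.

(** Polarization: the function vanishes on matrices whose rows [r] and [s] are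
    both the sum of the two given rows, and expanding leaves two terms. *)
Lemma alternating_tperm k (f : 'M[R]_(k, n) -> R) (r s : 'I_k) X :
  multilinear_rows f -> alternating_rows f -> r != s ->
  f (row_perm (tperm r s) X) = - f X.
Proof.
move=> fl fa rs; pose F u v := f (set_row r u (set_row s v X)).
have FDl u u' v : F (u + u') v = F u v + F u' v.
  have := multilinear_set_row r (set_row s v X) 1 1 u u' fl.
  by rewrite !scale1r !mul1r.
have setC u v : set_row r u (set_row s v X) = set_row s v (set_row r u X).
  apply/row_matrixP => i; rewrite !rowK; case: (eqVneq i r) => // ->.
  by rewrite (negPf rs).
have FDr u v v' : F u (v + v') = F u v + F u v'.
  rewrite /F !setC; have := multilinear_set_row s (set_row r u X) 1 1 v v' fl.
  by rewrite !scale1r !mul1r.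
have F0 u : F u u = 0.
  by apply: (fa _ r s) => //; rewrite !rowK eqxx eq_sym (negPf rs) eqxx.
have := F0 (row r X + row s X); rewrite FDl !FDr !F0 add0r addr0 => /eqP.
rewrite addrC addr_eq0 => /eqP; rewrite /F !set_row_id => FE.
have -> : row_perm (tperm r s) X = set_row r (row s X) (set_row s (row r X) X).
  apply/row_matrixP => i; apply/rowP => j; rewrite !rowK mxE.
  case: (eqVneq i r) => [->|ir]; first by rewrite mxE tpermL !mxE.
  case: (eqVneq i s) => [->|nis]; first by rewrite mxE tpermR !mxE.
  by rewrite mxE tpermD 1?eq_sym// !mxE.
by [].
Qed.

End Multilinear.

Section Determinant.
Context {R : realType}.

Lemma alternating_row_perm k n (f : 'M[R]_(k, n) -> R) (s : 'S_k) X :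
  multilinear_rows f -> alternating_rows f -> f X = 0 ->
  f (row_perm s X) = 0.
Proof.
move=> fl fa; case: (prod_tpermP s) => ts -> nts fX0 {s}.
elim: ts nts => [|[i j] ts IH] /=; first by rewrite big_nil row_perm1.
move=> /andP[/= ij nts]; rewrite big_cons row_permM /=.
by rewrite alternating_tperm// IH ?oppr0.
Qed.

(** Uniqueness of the determinant. By induction on [j], the function vanishes
    on matrices whose rows from the [j]-th on are vectors of the standard basis:
    expanding one more row reduces to the previous case. If all rows are such
    vectors, either two of them agree or the matrix is a permutation matrix. *)
Lemma alternating_eq0 n (f : 'M[R]_n -> R) :
  multilinear_rows f -> alternating_rows f -> f 1%:M = 0 -> forall X, f X = 0.
Proof.
move=> fl fa f1.
suff H j : forall X, (forall i : 'I_n, (j <= i)%N ->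
    exists k, row i X = delta_mx 0 k) -> f X = 0.
  by move=> X; apply: (H n) => i; rewrite leqNgt ltn_ord.
elim: j => [|j IH] X Xj.
  have [phi phiE] := fin_all_exists (fun i => Xj i (leq0n i)).
  have [/injectiveP phi_inj|/injectivePn[r [s rs phirs]]] :=
    boolP (injectiveb phi).
    suff -> : X = row_perm (perm phi_inj) 1%:M by exact: alternating_row_perm.
    apply/row_matrixP => i; rewrite phiE; apply/rowP => l.
    by rewrite !mxE permE eq_sym.
  by apply: (fa _ r s) => //; rewrite !phiE phirs.
have [jn|nj] := ltnP j n; last first.
  apply: IH => i ji; have := leq_trans nj ji.
  by rewrite leqNgt ltn_ord.
pose r := Ordinal jn; rewrite -(set_row_id r X) (row_sum_delta (row r X)).
rewrite multilinear_set_row_sum// big1// => k _.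
rewrite IH ?mulr0// => i ji; rewrite rowK; case: eqVneq => [_|ir].
  by exists k.
apply: Xj; rewrite ltn_neqAle ji andbT; apply: contra ir => /eqP ji'.
by apply/eqP/val_inj.
Qed.

Lemma multilinear_mulmxr k m n (f : 'M[R]_(k, n) -> R) (V : 'M[R]_(m, n)) :
  multilinear_rows f -> multilinear_rows (fun X : 'M[R]_(k, m) => f (X *m V)).
Proof.
have row'M (r : 'I_k) (Z : 'M[R]_(k, m)) : row' r (Z *m V) = row' r Z *m V.
  by apply/matrixP => i j; rewrite !mxE; apply: eq_bigr => l _; rewrite !mxE.
move=> fl A B C r b c Ar Br Cr; apply: (fl _ _ _ r).
- by rewrite !row_mul Ar mulmxDl !scalemxAl.
- by rewrite !row'M Br.
- by rewrite !row'M Cr.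
Qed.

Lemma alternating_mulmxr k m n (f : 'M[R]_(k, n) -> R) (V : 'M[R]_(m, n)) :
  alternating_rows f -> alternating_rows (fun X : 'M[R]_(k, m) => f (X *m V)).
Proof.
by move=> fa A r s rs Ars; apply: (fa _ r s) => //; rewrite !row_mul Ars.
Qed.

(** With [X = Y *m V], the function [Z |-> f (Z *m V)] is a multiple of the
    determinant, so [f X] is [\det Y * f V]. This transfers the nonvanishing of
    a top form from one basis to any other. *)
Lemma alternating_neq0 k n (f : 'M[R]_(k, n) -> R) (X V : 'M[R]_(k, n)) :
  multilinear_rows f -> alternating_rows f ->
  f X != 0 -> (X <= V)%MS -> f V != 0.
Proof.
move=> fl fa fX /submxP[Y XE]; apply: contra fX => /eqP fV.
rewrite XE; apply/eqP.
apply: (@alternating_eq0 _ (fun Z : 'M[R]_k => f (Z *m V))).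
- exact: multilinear_mulmxr.
- exact: alternating_mulmxr.
- by rewrite mul1mx.
Qed.

End Determinant.

(** * Wedge products are multilinear and alternating *)

Section Wedge.
Context {R : realType} {n : nat}.

Lemma row'_row k (r i : 'I_k) (X Y : 'M[R]_(k, n)) :
  row' r X = row' r Y -> i != r -> row i X = row i Y.
Proof.
move=> /row_matrixP e; rewrite eq_sym => /unlift_some[j -> _].
by apply/rowP => l; have /rowP/(_ l) := e j; rewrite !mxE.
Qed.

Lemma row_row_perm k (s : 'S_k) (X : 'M[R]_(k, n)) i :
  row i (row_perm s X) = row (s i) X.
Proof. by apply/rowP => j; rewrite !mxE. Qed.

Lemma row_usubmx k l (X : 'M[R]_(k + l, n)) i :
  row i (usubmx X) = row (lshift l i) X.
Proof. by apply/rowP => j; rewrite !mxE. Qed.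

Lemma row_dsubmx k l (X : 'M[R]_(k + l, n)) i :
  row i (dsubmx X) = row (rshift k i) X.
Proof. by apply/rowP => j; rewrite !mxE. Qed.

Lemma multilinear_row_perm k (f : 'M[R]_(k, n) -> R) (s : 'S_k) :
  multilinear_rows f -> multilinear_rows (f \o row_perm s).
Proof.
move=> fl A B C r b c Ar Br Cr /=; apply: (fl _ _ _ (s^-1 r)%g).
- by rewrite !row_row_perm permKV.
- apply: row'_eq => i ir; rewrite !row_row_perm; apply: (row'_row Br).
  by apply: contra ir => /eqP <-; rewrite permK.
- apply: row'_eq => i ir; rewrite !row_row_perm; apply: (row'_row Cr).
  by apply: contra ir => /eqP <-; rewrite permK.
Qed.

Lemma multilinear_tensor k l (f : 'M[R]_(k, n) -> R) (g : 'M[R]_(l, n) -> R) :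
  multilinear_rows f -> multilinear_rows g ->
  multilinear_rows (fun X : 'M[R]_(k + l, n) => f (usubmx X) * g (dsubmx X)).
Proof.
move=> fl gl A B C r b c Ar Br Cr.
have [r' rE|r' rE] := split_ordP r; rewrite {r}rE in Ar Br Cr.
- have dE X : row' (lshift l r') X = row' (lshift l r') A ->
      dsubmx X = dsubmx A.
    move=> E; apply/row_matrixP => i; rewrite !row_dsubmx.
    by apply: (row'_row E); rewrite eq_rlshift.
  have uE X : row' (lshift l r') X = row' (lshift l r') A ->
      row' r' (usubmx X) = row' r' (usubmx A).
    move=> E; apply: row'_eq => i ir; rewrite !row_usubmx.
    by apply: (row'_row E); rewrite eq_lshift.
  rewrite (dE B)// (dE C)// (fl _ (usubmx B) (usubmx C) r' b c) ?uE//.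
    by rewrite mulrDl !mulrA.
  by rewrite !row_usubmx.
- have dE X : row' (rshift k r') X = row' (rshift k r') A ->
      usubmx X = usubmx A.
    move=> E; apply/row_matrixP => i; rewrite !row_usubmx.
    by apply: (row'_row E); rewrite eq_lrshift.
  have uE X : row' (rshift k r') X = row' (rshift k r') A ->
      row' r' (dsubmx X) = row' r' (dsubmx A).
    move=> E; apply: row'_eq => i ir; rewrite !row_dsubmx.
    by apply: (row'_row E); rewrite eq_rshift.
  rewrite (dE B)// (dE C)// (gl _ (dsubmx B) (dsubmx C) r' b c) ?uE//.
    by rewrite mulrDr !(mulrCA (f _)).
  by rewrite !row_dsubmx.
Qed.

Lemma multilinearZ k (f : 'M[R]_(k, n) -> R) (a : R) :
  multilinear_rows f -> multilinear_rows (fun X => a * f X).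
Proof.
move=> fl A B C r b c Ar Br Cr.
by rewrite (fl A B C r b c)// mulrDr !(mulrCA a).
Qed.

Lemma multilinear_sum k (I : finType) (f : I -> 'M[R]_(k, n) -> R) :
  (forall i, multilinear_rows (f i)) ->
  multilinear_rows (fun X => \sum_i f i X).
Proof.
move=> fl A B C r b c Ar Br Cr; rewrite !mulr_sumr -big_split/=.
by apply: eq_bigr => i _; rewrite (fl i A B C r b c).
Qed.

Lemma multilinearD k (f g : 'M[R]_(k, n) -> R) :
  multilinear_rows f -> multilinear_rows g ->
  multilinear_rows (fun X => f X + g X).
Proof.
move=> fl gl A B C r b c Ar Br Cr.
by rewrite (fl A B C r b c)// (gl A B C r b c)//; ring.
Qed.

(** Composing with the transposition of the two equal rows pairs each
    permutation with one of the opposite sign giving the same value. *)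
Lemma alternating_antisym k (f : 'M[R]_(k, n) -> R) :
  alternating_rows (fun X => \sum_(s : 'S_k) (-1) ^+ s * f (row_perm s X)).
Proof.
move=> A r t rt Art; set S := LHS.
suff SN : S = - S.
  by have := addrN S; rewrite -SN -mulr2n => /eqP; rewrite mulrn_eq0/= => /eqP.
rewrite {1}/S (reindex_inj (mulIg (tperm r t)))/= -sumrN.
apply: eq_bigr => s _; rewrite odd_permM odd_tperm rt addbT signrN mulNr.
congr (- (_ * f _)); apply/row_matrixP => i; rewrite !row_row_perm permM.
by case: tpermP => // ->.
Qed.

Context {M : smooth_manifold R n}.
Implicit Types (i : atlas_index M).

Lemma wedge_multilinear k l (w : local_form M k) (e : local_form M l) i x :
  multilinear_rows (w i x) -> multilinear_rows (e i x) ->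
  multilinear_rows (form_wedge w e i x).
Proof.
move=> wl el; apply/multilinearZ/multilinear_sum => s; apply/multilinearZ.
exact: (multilinear_row_perm s (multilinear_tensor wl el)).
Qed.

Lemma wedge_alternating k l (w : local_form M k) (e : local_form M l) i x :
  alternating_rows (form_wedge w e i x).
Proof.
move=> A r s rs Ars; rewrite /form_wedge.
pose F (X : 'M[R]_(k + l, n)) := w i x (usubmx X) * e i x (dsubmx X).
by rewrite (alternating_antisym F rs Ars) mulr0.
Qed.

Lemma pow_multilinear k (w : local_form M k) m i x :
  multilinear_rows (w i x) -> multilinear_rows (form_pow w m i x).
Proof.
move=> wl; elim: m => [|m IH] /=; first by move=> A B C [].
exact: wedge_multilinear.
Qed.

Lemma wedge_eq0 k l (w : local_form M k) (e : local_form M l) i x V :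
  (forall s : 'S_(k + l), w i x (usubmx (row_perm s V)) = 0 \/
     e i x (dsubmx (row_perm s V)) = 0) ->
  form_wedge w e i x V = 0.
Proof.
move=> H; rewrite /form_wedge big1 ?mulr0// => s _.
by case: (H s) => ->; rewrite ?mulr0 ?mul0r ?mulr0.
Qed.

(** A power of [w] is a sum of products of values of [w], and in each product
    one factor has [u] as an argument. So it vanishes on vectors of [K] as soon
    as [u] is one of them and [w] pairs [u] to zero with [K]. *)
Lemma pow_eq0 (w : local_form M 2) i x (u : 'rV[R]_n) (K : set 'rV[R]_n) :
  (forall Y : 'M[R]_(2, n), (exists r, row r Y = u) ->
     (forall r, K (row r Y)) -> w i x Y = 0) ->
  forall m (X : 'M[R]_(m * 2, n)),
  (exists r, row r X = u) -> (forall r, K (row r X)) ->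
  form_pow w m i x X = 0.
Proof.
move=> wK; elim=> [|m IH] X [r Xr] XK; first by case: r {Xr}.
apply: (@wedge_eq0 2 (m * 2)) => s.
have : exists t, row t (row_perm s X) = u.
  by exists (s^-1 r)%g; rewrite row_row_perm permKV.
case=> t; have [t' ->|t' ->] := @split_ordP 2 (m * 2) t => tE.
- left; apply: wK; first by exists t'; rewrite row_usubmx.
  by move=> j; rewrite row_usubmx row_row_perm.
- right; apply: IH; first by exists t'; rewrite row_dsubmx.
  by move=> j; rewrite row_dsubmx row_row_perm.
Qed.

End Wedge.

(** * Bases adapted to two linear forms *)

Section OneForm.
Context {R : realType} {n : nat}.
Implicit Types (f g : 'rV[R]_n -> R).

Lemma multilinear1P f : multilinear_rows f ->
  forall a b u v, f (a *: u + b *: v) = a * f u + b * f v.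
Proof.
move=> fl a b u v; apply: (fl _ _ _ 0); first by rewrite !row_id.
- by apply/matrixP => -[].
- by apply/matrixP => -[].
Qed.

Lemma multilinear10 f : multilinear_rows f -> f 0 = 0.
Proof.
by move=> /multilinear1P/(_ 0 0 0 0); rewrite scale0r addr0 !mul0r addr0.
Qed.

Lemma multilinear1Z f a u : multilinear_rows f -> f (a *: u) = a * f u.
Proof.
by move=> /multilinear1P/(_ a 0 u 0); rewrite scaler0 addr0 mul0r addr0.
Qed.

Lemma multilinear1D f u v : multilinear_rows f -> f (u + v) = f u + f v.
Proof. by move=> /multilinear1P/(_ 1 1 u v); rewrite !scale1r !mul1r. Qed.

Lemma row2E (Y : 'M[R]_(2, n)) :
  Y = col_mx (row 0 Y) (row 1 Y) :> 'M[R]_(1 + 1, n).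
Proof.
apply/row_matrixP => r; have [j ->|j ->] := @split_ordP 1 1 r.
- apply/rowP => l; rewrite mxE [RHS]mxE col_mxEu mxE (ord1 j).
  by congr (Y _ l); apply/val_inj.
- apply/rowP => l; rewrite mxE [RHS]mxE col_mxEd mxE (ord1 j).
  by congr (Y _ l); apply/val_inj.
Qed.

Section TwoForm.
Variables (f : 'M[R]_(1 + 1, n) -> R) (fl : multilinear_rows f).

Lemma multilinear2l v : multilinear_rows (fun u : 'rV[R]_n => f (col_mx u v)).
Proof.
move=> A B C r b c; rewrite (ord1 r) !row_id => -> _ _.
apply: (fl (r := 0)).
- by apply/rowP => j; rewrite !mxE; case: splitP => // k _; rewrite !mxE (ord1 k).
- apply: row'_eq => k; have [l ->|l -> _] := split_ordP k.
    by rewrite (ord1 l).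
  by apply/rowP => j; rewrite !mxE (unsplitK (inr l)).
- apply: row'_eq => k; have [l ->|l -> _] := split_ordP k.
    by rewrite (ord1 l).
  by apply/rowP => j; rewrite !mxE (unsplitK (inr l)).
Qed.

Lemma multilinear2r u : multilinear_rows (fun v : 'rV[R]_n => f (col_mx u v)).
Proof.
move=> A B C r b c; rewrite (ord1 r) !row_id => -> _ _.
apply: (fl (r := rshift 1 0)).
- by apply/rowP => j; rewrite !mxE (unsplitK (inr _)) !mxE.
- apply: row'_eq => k; have [l -> _|l ->] := split_ordP k.
    by apply/rowP => j; rewrite !mxE (unsplitK (inl l)).
  by rewrite (ord1 l) eqxx.
- apply: row'_eq => k; have [l -> _|l ->] := split_ordP k.
    by apply/rowP => j; rewrite !mxE (unsplitK (inl l)).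
  by rewrite (ord1 l) eqxx.
Qed.

Lemma multilinear2Zl a u v : f (col_mx (a *: u) v) = a * f (col_mx u v).
Proof. exact: (multilinear1Z a u (multilinear2l v)). Qed.

Lemma multilinear2Zr a u v : f (col_mx u (a *: v)) = a * f (col_mx u v).
Proof. exact: (multilinear1Z a v (multilinear2r u)). Qed.

End TwoForm.

Definition at_most_one_row k f (V : 'M[R]_(k, n)) :=
  forall i j, i != j -> f (row i V) = 0 \/ f (row j V) = 0.

(** One step of elimination on the values of [f], with pivot [r]. Rows where
    [f] vanishes are kept, and so are the values of any form [g] that vanishes
    on the pivot: this is what allows a second elimination that does not spoil
    the first. *)
Lemma pivot_row k f (V : 'M[R]_(k, n)) r :
  multilinear_rows f -> f (row r V) != 0 ->
  exists W : 'M[R]_(k, n), [/\ (V <= W)%MS,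
    forall i, i != r -> f (row i W) = 0,
    forall i, f (row i V) = 0 -> row i W = row i V &
    forall g i, multilinear_rows g -> g (row r V) = 0 ->
      g (row i W) = g (row i V)].
Proof.
move=> fl fr.
pose c i := if i == r then 0 else - (f (row i V) / f (row r V)).
pose W := \matrix_i (row i V + c i *: row r V).
have WE i : row i W = row i V + c i *: row r V by rewrite rowK.
have Wr : row r W = row r V by rewrite WE /c eqxx scale0r addr0.
exists W; split.
- apply/row_subP => i.
  have -> : row i V = row i W - c i *: row r W by rewrite WE Wr addrK.
  by rewrite addmx_sub ?eqmx_opp ?scalemx_sub ?row_sub.
- move=> i /negPf ir; rewrite WE multilinear1D// multilinear1Z// /c ir.
  by rewrite mulNr divfK// addrN.
- by move=> i fi; rewrite WE /c fi mul0r oppr0 if_same scale0r addr0.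
- by move=> g i gl gr; rewrite WE multilinear1D// multilinear1Z// gr mulr0 addr0.
Qed.

(** Eliminate with respect to [f], then with respect to [g] using a pivot where
    [f] vanishes. If there is no such pivot, [g] can be nonzero only on the
    row where [f] is. The last clause is used to keep in the basis a prescribed
    vector of the common kernel. *)
Lemma adapted_basis k f g (V : 'M[R]_(k, n)) :
  multilinear_rows f -> multilinear_rows g ->
  exists W : 'M[R]_(k, n), [/\ (V <= W)%MS, at_most_one_row f W,
    at_most_one_row g W &
    forall i, f (row i V) = 0 -> g (row i V) = 0 -> row i W = row i V].
Proof.
move=> fl gl.
have [W [VW Wf Wid]] : exists W : 'M[R]_(k, n), [/\ (V <= W)%MS,
    at_most_one_row f W & forall i, f (row i V) = 0 -> row i W = row i V].
  have [[r fr]|/forallNP fV] := pselect (exists r, f (row r V) != 0).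
    have [W [VW Wf Wid _]] := pivot_row fl fr; exists W; split => // i j ij.
    have [ir|/Wf] := eqVneq i r; last by left.
    by right; apply: Wf; rewrite -ir eq_sym.
  exists V; split => // i j _; left; apply/eqP/negPn/negP; exact: fV.
have [[r [fr gr]]|/forallNP gW] :=
    pselect (exists r, f (row r W) = 0 /\ g (row r W) != 0).
  have [U [WU Ug Uid UE]] := pivot_row gl gr; exists U; split.
  - exact: submx_trans WU.
  - by move=> i j ij; rewrite !(UE f)//; exact: Wf.
  - move=> i j ij; have [ir|/Ug] := eqVneq i r; last by left.
    by right; apply: Ug; rewrite -ir eq_sym.
  - by move=> i fi gi; rewrite Uid Wid.
have fg0 i : f (row i W) = 0 -> g (row i W) = 0.
  by move=> fi; apply/eqP/negPn/negP => gi; apply: (gW i).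
exists W; split => // [i j /Wf[]/fg0|i fi _]; [by left|by right|exact: Wid].
Qed.

End OneForm.

(** * Nonvanishing of the volume form at a point *)

Section ContactPairAtPoint.
Context {R : realType} {n : nat} {M : smooth_manifold R n}.
Variables (alpha beta : local_form M 1) (w : local_form M 2).
Variables (i : atlas_index M) (x : 'rV[R]_n) (h : nat).
Local Notation a := (alpha i x).
Local Notation b := (beta i x).
Local Notation Omega := (form_wedge (form_wedge alpha (form_pow w h)) beta i x).
Hypotheses (al : multilinear_rows a) (bl : multilinear_rows b)
  (wl : multilinear_rows (w i x)) (dimM : (1 + h * 2 + 1)%N = n)
  (Omega_neq0 : exists V, Omega V != 0).

Lemma volume_neq0 (V : 'M[R]_(1 + h * 2 + 1, n)) : row_full V -> Omega V != 0.
Proof.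
case: Omega_neq0 => X OX Vf; apply: (alternating_neq0 _ _ OX).
- apply: wedge_multilinear => //; apply: wedge_multilinear => //.
  exact: pow_multilinear.
- exact: wedge_alternating.
- exact: submx_full.
Qed.

Lemma usubmx_row0 k (X : 'M[R]_(1 + k, n)) : usubmx X = row 0 X.
Proof. by apply/rowP => j; rewrite !mxE; congr (X _ j); apply/val_inj. Qed.

(** In a term of the expansion of the volume form that is not obviously zero,
    [beta] takes the row [q] and [alpha] the row [p], with nonzero values, and
    the power of [w] is evaluated on the remaining rows, gathered in [X]. *)
Lemma volume_eq0 V :
  (forall p q (X : 'M[R]_(h * 2, n)), p != q ->
     a (row p V) != 0 -> b (row q V) != 0 ->
     (forall j, exists l, [/\ l != p, l != q & row j X = row l V]) ->
     (forall l, l != p -> l != q -> exists j, row j X = row l V) ->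
     form_pow w h i x X = 0) ->
  Omega V = 0.
Proof.
move=> H; apply: wedge_eq0 => s; set U := usubmx _.
have rowU j : row j U = row (s (lshift 1 j)) V by rewrite row_usubmx row_row_perm.
set q := s (rshift (1 + h * 2) 0).
have -> : dsubmx (row_perm s V) = row q V.
  by apply/rowP => j; rewrite !mxE; congr (V (s _) j); apply/val_inj.
have [->|bq] := eqVneq (b (row q V)) 0; [by right|left].
apply: (@wedge_eq0 _ _ _ 1 (h * 2)) => t.
set p := s (lshift 1 (t (lshift (h * 2) 0))).
have -> : usubmx (row_perm t U) = row p V.
  rewrite usubmx_row0 row_row_perm rowU /p.
  by congr (row (s (lshift _ (t _))) V); apply/val_inj.
have [->|ap] := eqVneq (a (row p V)) 0; [by left|right].
apply: (H p q) => //.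
- by rewrite (inj_eq perm_inj) eq_lrshift.
- move=> j; exists (s (lshift 1 (t (rshift 1 j)))); split.
  + by rewrite (inj_eq perm_inj) eq_lshift (inj_eq perm_inj) eq_rlshift.
  + by rewrite (inj_eq perm_inj) eq_lrshift.
  + by rewrite row_dsubmx row_row_perm rowU.
- move=> l lp lq.
  have [l' lE|l' lE] := split_ordP ((s^-1)%g l); last first.
    by case/eqP: lq; rewrite -(permKV s l) lE (ord1 l').
  have [j jE|j jE] := @split_ordP 1 (h * 2) ((t^-1)%g l').
    by case/eqP: lp; rewrite -(permKV s l) lE -(permKV t l') jE (ord1 j).
  by exists j; rewrite row_dsubmx row_row_perm rowU -jE permKV -lE permKV.
Qed.

(** In an adapted basis, a nonzero term requires distinct rows [p] and [q] with
    [a] nonzero only on [p] and [b] nonzero only on [q]; no nontrivial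
    combination of [a] and [b] vanishes on both rows. *)
Lemma contact_independent (s t : R) :
  (forall v, s * a v + t * b v = 0) -> s = 0 /\ t = 0.
Proof.
move=> st; pose V0 : 'M[R]_(1 + h * 2 + 1, n) := pid_mx n.
have [V [V0V aV bV _]] := adapted_basis V0 al bl.
have Vfull : row_full V.
  by rewrite -sub1mx (submx_trans _ V0V)// sub1mx /row_full rank_pid_mx// dimM.
apply: contrapT => nst; case/eqP: (volume_neq0 Vfull).
apply: volume_eq0 => p q X pq ap bq _ _; case: nst.
have ap' : a (row q V) = 0.
  by case: (aV p q pq) => // E; rewrite E eqxx in ap.
have bp : b (row p V) = 0.
  by case: (bV p q pq) => // E; rewrite E eqxx in bq.
split; apply/eqP.
- by have /eqP := st (row p V); rewrite bp mulr0 addr0 mulf_eq0 (negPf ap) orbF.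
- by have /eqP := st (row q V); rewrite ap' mulr0 add0r mulf_eq0 (negPf bq) orbF.
Qed.

(** If [u] were nonzero it could be made part, up to a scalar, of an adapted
    basis. In any term the power of [w] is then evaluated on vectors of the
    common kernel of [a] and [b], one of them being [u], so it vanishes. *)
Lemma contact_nondegenerate (u : 'rV[R]_n) :
  a u = 0 -> b u = 0 ->
  (forall v, a v = 0 -> b v = 0 ->
     w i x (col_mx u v) = 0 /\ w i x (col_mx v u) = 0) ->
  u = 0.
Proof.
move=> au bu wu; apply/eqP; apply: contraT => u_neq0.
have n_gt0 : (0 < n)%N by rewrite -dimM addn1.
pose r0 : 'I_n := Ordinal n_gt0.
(* The Gaussian elimination of the single row [u] provides an invertible matrix
   whose first row is proportional to [u]. *)
pose G : 'M[R]_n := row_ebase u.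
have uE : u = (col_ebase u 0 0) *: row r0 G.
  rewrite -[LHS]mulmx_ebase rank_rV u_neq0 [col_ebase u]mx11_scalar -mulmxA.
  rewrite mul_scalar_mx mxE rowE; congr (_ *: (_ *m _)).
  by apply/rowP => j; rewrite !mxE eqxx/= -val_eqE/= eq_sym; case: (val j).
pose k := col_ebase u 0 0; pose u' := row r0 G.
have k_neq0 : k != 0.
  by apply: contra u_neq0 => /eqP k0; rewrite uE -/k k0 scale0r.
have au' : a u' = 0.
  move: au; rewrite uE multilinear1Z// => /eqP.
  by rewrite mulf_eq0 (negPf k_neq0) => /eqP.
have bu' : b u' = 0.
  move: bu; rewrite uE multilinear1Z// => /eqP.
  by rewrite mulf_eq0 (negPf k_neq0) => /eqP.
pose V0 : 'M[R]_(1 + h * 2 + 1, n) := pid_mx n *m G.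
have [V [V0V aV bV Vid]] := adapted_basis V0 al bl.
have Vfull : row_full V.
  rewrite -sub1mx (submx_trans _ V0V)// sub1mx /row_full.
  by rewrite mxrankMfree ?row_free_unit ?row_ebase_unit// rank_pid_mx// dimM.
pose q0 : 'I_(1 + h * 2 + 1) := cast_ord (esym dimM) r0.
have V0u' : row q0 V0 = u'.
  rewrite row_mul /u' [RHS]rowE; congr (_ *m _); apply/rowP => j.
  by rewrite !mxE eqxx/= -val_eqE/= n_gt0 andbT eq_sym.
have Vu' : row q0 V = u' by rewrite Vid V0u'.
case/negP: (volume_neq0 Vfull); apply/eqP/volume_eq0 => p q X pq ap bq rX Xr.
apply: (@pow_eq0 _ _ _ w i x u' [set v | a v = 0 /\ b v = 0]).
- move=> Y [r Yr] YK.
  have wu' v : a v = 0 -> b v = 0 ->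
      w i x (col_mx u' v) = 0 /\ w i x (col_mx v u') = 0.
    move=> av bv; have [] := wu v av bv; rewrite uE -/k -/u'.
    rewrite multilinear2Zl// multilinear2Zr// => /eqP + /eqP.
    by rewrite !mulf_eq0 (negPf k_neq0) => /eqP -> /eqP ->.
  have [rE|rE] : r = 0 \/ r = 1.
  + by case: r {Yr} => -[|[|//]] r_lt; [left|right]; apply/val_inj.
  + by rewrite (row2E Y) -rE Yr; case: (wu' (row 1 Y)) => //; case: (YK 1).
  + by rewrite (row2E Y) -rE Yr; case: (wu' (row 0 Y)) => //; case: (YK 0).
- rewrite -Vu'; apply: Xr; first by apply: contra ap => /eqP <-; rewrite Vu' au'.
  by apply: contra bq => /eqP <-; rewrite Vu' bu'.
- move=> j; have [l [lp lq ->]] := rX j; split.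
  + by case: (aV p l); rewrite 1?eq_sym// => E; rewrite E eqxx in ap.
  + by case: (bV q l); rewrite 1?eq_sym// => E; rewrite E eqxx in bq.
Qed.

End ContactPairAtPoint.

(** * Wedge products in low degree *)

Section LowDegreeWedge.
Context {R : realType} {n : nat} {M : smooth_manifold R n}.

(** Sorts permutations by the image of [0], to enumerate the permutations of two
    and three elements. *)
Lemma sum_lift_perm k (F : 'S_k.+1 -> R) :
  \sum_s F s = \sum_(j < k.+1) \sum_(t : 'S_k) F (lift_perm 0 j t).
Proof.
rewrite (partition_big (fun s : 'S_k.+1 => s 0) predT)//=.
apply: eq_bigr => j _; rewrite (reindex (lift_perm 0 j)); last first.
  pose ulsf (s : 'S_k.+1) l := odflt l (unlift (s 0) (s (lift 0 l))).
  have ulsfK (s : 'S_k.+1) l : lift (s 0) (ulsf s l) = s (lift 0 l).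
    rewrite /ulsf; have:= neq_lift 0 l.
    by rewrite -(can_eq (permK s)) => /unlift_some[] ? ? ->.
  have inj_ulsf : injective (ulsf _).
    move=> s l l' /(congr1 (lift (s 0))); rewrite !ulsfK.
    by move/perm_inj/lift_inj.
  exists (fun s => perm (inj_ulsf s)) => [s _ | s].
    by apply/permP=> k'; rewrite permE /ulsf lift_perm_lift lift_perm_id liftK.
  move/(s _ =P _) => si0; apply/permP=> l.
  case: (unliftP 0 l) => [l'|] ->; rewrite ?lift_perm_id //.
  by rewrite lift_perm_lift -si0 permE ulsfK.
by apply: eq_bigl => t; rewrite lift_perm_id eqxx.
Qed.

Lemma sum_perm0 (F : 'S_0 -> R) : \sum_s F s = F 1%g.
Proof.
rewrite (bigD1 1%g)//= big1 ?addr0// => s /eqP[].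
by apply/permP => -[].
Qed.

Lemma sum_perm1 (F : 'S_1 -> R) : \sum_s F s = F 1%g.
Proof. by rewrite sum_lift_perm big_ord1 sum_perm0 lift_perm1. Qed.

Lemma sum_perm2 (F : 'S_2 -> R) :
  \sum_s F s = F (lift_perm 0 0 1%g) + F (lift_perm 0 1 1%g).
Proof.
rewrite sum_lift_perm; under eq_bigr do rewrite sum_perm1.
rewrite !big_ord_recl big_ord0 addr0.
by congr (_ + F (lift_perm _ _ _)); apply/val_inj.
Qed.

Lemma sum_perm3 (F : 'S_3 -> R) :
  \sum_s F s = \sum_(j < 3) (F (lift_perm 0 j (lift_perm 0 0 1%g)) +
                             F (lift_perm 0 j (lift_perm 0 1 1%g))).
Proof. by rewrite sum_lift_perm; under eq_bigr do rewrite sum_perm2. Qed.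

Lemma wedge11E (a b : local_form M 1) i x V :
  form_wedge a b i x V =
  a i x (row 0 V) * b i x (row 1 V) - a i x (row 1 V) * b i x (row 0 V).
Proof.
have uE s : usubmx (row_perm s V : 'M[R]_(1 + 1, n)) = row (s 0) V.
  by apply/rowP => j; rewrite !mxE; congr (V (s _) j); apply/val_inj.
have dE s : dsubmx (row_perm s V : 'M[R]_(1 + 1, n)) = row (s 1) V.
  by apply/rowP => j; rewrite !mxE; congr (V (s _) j); apply/val_inj.
have l1 : 1 = lift 0 0 :> 'I_2 by apply/val_inj.
rewrite /form_wedge (@sum_perm2 (fun s => _ * _)) !uE !dE !lift_perm_id.
rewrite l1 !lift_perm_lift perm1 -l1 !odd_lift_perm !odd_perm1 mul1n.
rewrite (_ : lift 1 0 = 0); last exact/val_inj.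
by rewrite invr1/= expr0 expr1; ring.
Qed.

Lemma alternating2C (f : 'M[R]_(1 + 1, n) -> R) u v :
  multilinear_rows f -> alternating_rows f -> f (col_mx u v) = - f (col_mx v u).
Proof.
move=> fl fa; rewrite -(@alternating_tperm _ _ _ f (lshift 1 0) (rshift 1 0))//.
congr f; apply/row_matrixP => j; rewrite row_row_perm.
by case: (split_ordP j) => l ->; rewrite (ord1 l) ?tpermL ?tpermR;
  apply/rowP => m; rewrite !mxE ?(unsplitK (inl _)) ?(unsplitK (inr _)).
Qed.

Lemma wedge21E (w : local_form M 2) (b : local_form M 1) i x V :
  multilinear_rows (w i x) -> alternating_rows (w i x) ->
  form_wedge w b i x V =
  w i x (col_mx (row 0 V) (row 1 V)) * b i x (row (2 : 'I_3) V) -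
  w i x (col_mx (row 0 V) (row (2 : 'I_3) V)) * b i x (row 1 V) +
  w i x (col_mx (row 1 V) (row (2 : 'I_3) V)) * b i x (row 0 V).
Proof.
move=> wl wa.
have uE s : usubmx (row_perm s V : 'M[R]_(2 + 1, n)) =
    col_mx (row (s 0) V) (row (s 1) V) :> 'M[R]_(1 + 1, n).
  rewrite [LHS]row2E !row_usubmx !row_row_perm.
  by congr (col_mx (row (s _) V) (row (s _) V)); apply/val_inj.
have dE s : dsubmx (row_perm s V : 'M[R]_(2 + 1, n)) = row (s 2) V.
  by apply/rowP => j; rewrite !mxE; congr (V (s _) j); apply/val_inj.
have v1 j t : lift_perm 0 j t (1 : 'I_3) = lift j (t 0).
  by rewrite -(lift_perm_lift 0); congr (lift_perm _ _ _ _); apply/val_inj.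
have v2 j t : lift_perm 0 j t (2 : 'I_3) = lift j (t 1).
  by rewrite -(lift_perm_lift 0); congr (lift_perm _ _ _ _); apply/val_inj.
have v3 j : lift_perm 0 j 1%g (1 : 'I_2) = lift j 0.
  rewrite -[in RHS](perm1 0) -(lift_perm_lift 0).
  by congr (lift_perm _ _ _ _); apply/val_inj.
have liftE : ((lift 0 (lift 0 0) = 2 :> 'I_3) * (lift 0 0 = 1 :> 'I_3) *
    (lift 0 1 = 2 :> 'I_3) * (lift 1 0 = 0 :> 'I_3) * (lift 1 1 = 2 :> 'I_3) *
    (lift 2 0 = 0 :> 'I_3) * (lift 2 1 = 1 :> 'I_3) * (lift 0 0 = 1 :> 'I_2) *
    (lift 1 0 = 0 :> 'I_2))%type.
  by do ![split]; apply/val_inj.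
have ord0E k : ord0 = 0 :> 'I_k.+1 by [].
rewrite /form_wedge (@sum_perm3 (fun s => _ * _)) !big_ord_recl big_ord0 /=.
rewrite !uE !dE !(lift_perm_id, v1, v2, v3) !ord0E !liftE.
rewrite !odd_lift_perm !odd_perm1 /= (_ : (2`! * 1`!)%N = 2%N)// expr0 expr1.
rewrite !(alternating2C (row 1 V) (row 0 V) wl wa).
rewrite !(alternating2C (row 2 V) _ wl wa).
by field.
Qed.
End LowDegreeWedge.

(** * Linear algebra of 2-forms and bordered matrices *)

Section PointwiseNondegeneracy.
Context {R : realType} {n : nat}.
Implicit Types (f g : 'rV[R]_n -> R) (F : 'M[R]_(1 + 1, n) -> R).

Definition one_form_col f : 'cV[R]_n := \col_k f (delta_mx 0 k).

Lemma one_form_colE f v : multilinear_rows f -> f v = (v *m one_form_col f) 0 0.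
Proof.
move=> fl; rewrite {1}(row_sum_delta v) mxE.
apply: (big_ind2 (fun u y => f u = y)) => [|u y v' z <- <-|k _].
- exact: multilinear10.
- exact: multilinear1D.
- by rewrite multilinear1Z// mxE.
Qed.

Lemma common_zero f g : multilinear_rows f -> multilinear_rows g -> (2 < n)%N ->
  exists u, [/\ u != 0, f u = 0 & g u = 0].
Proof.
move=> fl gl n2; pose C := row_mx (one_form_col f) (one_form_col g).
have : kermx C != 0.
  by rewrite kermx_eq0 /row_free neq_ltn (leq_ltn_trans (rank_leq_col _) n2).
case/rowV0Pn => u /sub_kermxP; rewrite mul_mx_row => uC u0.
exists u.
have := congr1 (@lsubmx _ 1 1 1) uC; have := congr1 (@rsubmx _ 1 1 1) uC.
rewrite row_mxKl row_mxKr !linear0 => gu fu.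
by split => //; rewrite one_form_colE// ?fu ?gu mxE.
Qed.

(** If [f z] were nonzero, pick [u] nonzero with [f u = 0] and [F(u, z) = 0],
    which is possible in dimension at least 3. The hypothesis then reduces to
    [F(u, v) * f z = 0] for all [v], so [u] is in the radical of [F]. *)
Lemma wedge_injective F f : multilinear_rows F -> multilinear_rows f ->
  (2 < n)%N -> (forall u, (forall v, F (col_mx u v) = 0) -> u = 0) ->
  (forall u v z, F (col_mx u v) * f z - F (col_mx u z) * f v +
                 F (col_mx v z) * f u = 0) ->
  forall z, f z = 0.
Proof.
move=> Fl fl n2 Fnd Ff z; apply/eqP/negPn/negP => fz.
have [u [u0 fu Fu]] := common_zero fl (multilinear2l Fl z) n2.
case/eqP: u0; apply: Fnd => v; have := Ff u v z.
rewrite fu Fu mul0r mulr0 subr0 addr0 => /eqP.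
by rewrite mulf_eq0 (negPf fz) orbF => /eqP.
Qed.

Definition two_form_mx F : 'M[R]_n :=
  \matrix_(k, l) F (col_mx (delta_mx 0 k) (delta_mx 0 l)).

Lemma two_form_mxE F u v : multilinear_rows F ->
  F (col_mx u v) = (u *m two_form_mx F *m v^T) 0 0.
Proof.
move=> Fl; rewrite -(trmxK (u *m _)) -trmx_mul [RHS]mxE.
rewrite (one_form_colE v (multilinear2r Fl u)); congr ((v *m _) 0 0).
apply/colP => k; rewrite mxE (one_form_colE u (multilinear2l Fl _)) !mxE.
by apply: eq_bigr => l _; rewrite !mxE.
Qed.

(** The form [F] bordered by [f] and [g]. Its Schur complement with respect to
    the lower right block, invertible for [t != 0], is the matrix of
    [F + t^-1 (f /\ g)]; but [t = 0] makes sense too, which gives access to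
    large multiples of [f /\ g] by continuity. *)
Definition bordered_mx F f g (t : R) : 'M[R]_(n + (1 + 1)) :=
  block_mx (two_form_mx F) (row_mx (one_form_col f) (one_form_col g))
    (col_mx (one_form_col f)^T (one_form_col g)^T)
    (block_mx 0 t%:M (- t)%:M 0).

Lemma mul_bordered F f g t (u : 'rV[R]_n) (s r : 'rV[R]_1) :
  row_mx u (row_mx s r) *m bordered_mx F f g t =
  row_mx (u *m two_form_mx F +
          (s *m (one_form_col f)^T + r *m (one_form_col g)^T))
    (row_mx (u *m one_form_col f - t *: r) (u *m one_form_col g + t *: s)).
Proof.
rewrite mul_row_block mul_row_col mul_mx_row mul_row_block.
by rewrite !mulmx0 addr0 add0r !mul_mx_scalar add_row_mx scaleNr.
Qed.

(** A vector (u, s, r) in the left kernel for [t = 0] satisfies [f u = g u = 0]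
    and [F(u, _) = - (s f + r g)]. So [u] is orthogonal to the common kernel of
    [f] and [g], hence zero, and then [s] and [r] vanish by independence. *)
Lemma bordered_det_neq0 F f g :
  multilinear_rows F -> alternating_rows F ->
  multilinear_rows f -> multilinear_rows g ->
  (forall s t : R, (forall v, s * f v + t * g v = 0) -> s = 0 /\ t = 0) ->
  (forall u, f u = 0 -> g u = 0 ->
    (forall v, f v = 0 -> g v = 0 -> F (col_mx u v) = 0 /\ F (col_mx v u) = 0) ->
    u = 0) ->
  \det (bordered_mx F f g 0) != 0.
Proof.
move=> Fl Fa fl gl ind nd; apply/det0P => -[z z0].
rewrite -(hsubmxK z) -[rsubmx z]hsubmxK; set u := lsubmx z.
set s := @lsubmx _ _ 1 1 _; set r := @rsubmx _ _ 1 1 _.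
rewrite mul_bordered !scale0r addr0 subr0 -[0]hsubmxK -[rsubmx 0]hsubmxK !linear0.
move=> /eq_row_mx[Fu /eq_row_mx[fu gu]].
have FE v : F (col_mx u v) + (s 0 0 * f v + r 0 0 * g v) = 0.
  rewrite two_form_mxE// (one_form_colE v fl) (one_form_colE v gl).
  have := congr1 (fun X => (X *m v^T) 0 0) Fu; rewrite mul0mx [X in _ = X]mxE => <-.
  rewrite !mulmxDl [RHS]mxE [X in _ = _ + X]mxE; congr (_ + (_ + _)).
    by rewrite -mulmxA -trmx_mul [RHS]mxE big_ord1 [X in _ = _ * X]mxE.
  by rewrite -mulmxA -trmx_mul [RHS]mxE big_ord1 [X in _ = _ * X]mxE.
have u0 : u = 0.
  apply: nd; rewrite ?one_form_colE ?fu ?gu ?mxE// => v fv gv.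
  have := FE v; rewrite fv gv !mulr0 !addr0 => Fuv.
  by rewrite [X in _ /\ X = _]alternating2C// Fuv oppr0.
have [s0 r0] : s 0 0 = 0 /\ r 0 0 = 0.
  apply: ind => v; have := FE v.
  by rewrite u0 (multilinear10 (multilinear2l Fl v)) add0r.
case/eqP: z0; rewrite -(hsubmxK z) -/u u0 -[rsubmx z]hsubmxK -/s -/r.
by rewrite [s]mx11_scalar [r]mx11_scalar s0 r0 !raddf0 !row_mx0.
Qed.

Lemma bordered_nondegenerate F f g c :
  multilinear_rows F -> multilinear_rows f -> multilinear_rows g -> c != 0 ->
  \det (bordered_mx F f g c^-1) != 0 ->
  forall u, (forall v, F (col_mx u v) + c * (f u * g v - f v * g u) = 0) ->
    u = 0.
Proof.
move=> Fl fl gl c0 Bdet u uE; apply/eqP; apply: contraNT Bdet => u0.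
(* These are the only last two coordinates for which the two bordering columns
   give zero. *)
apply/det0P; exists (row_mx u (row_mx (- c * g u)%:M (c * f u)%:M)).
  apply: contra u0 => /eqP; rewrite -[0]hsubmxK => /eq_row_mx[-> _].
  by rewrite linear0.
rewrite mul_bordered -[RHS]hsubmxK -[rsubmx 0]hsubmxK !linear0.
congr (row_mx _ (row_mx _ _)).
- apply/rowP => k; have := uE (delta_mx 0 k).
  rewrite two_form_mxE// trmx_delta -colE !mul_scalar_mx !mxE => E.
  by rewrite -[RHS]E; congr (_ + _); ring.
- apply/matrixP => i j; rewrite !ord1 mxE -one_form_colE// !mxE.
  by rewrite eqxx mulr1n mulKf// subrr.
- apply/matrixP => i j; rewrite !ord1 mxE -one_form_colE// !mxE.
  by rewrite eqxx mulr1n mulNr mulrN mulKf// subrr.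
Qed.

End PointwiseNondegeneracy.

(** * Functions of class C^k *)

Section SmoothClosure.
Context {R : realType} {n : nat}.
Implicit Types (U : set 'rV[R]_n).

(** Differentiability is a local property: [g] has the same first order
    expansion at [x] as [f], with the same linear part. *)
Lemma near_eq_differentiable {V W : normedModType R} (f g : V -> W) (x : V) :
  (\forall y \near x, f y = g y) -> differentiable f x -> differentiable g x.
Proof.
move=> fg df.
have gE : g \o shift x = cst (g x) + 'd f x +o_ 0 id.
  apply/eqaddoP => _/posnumP[e].
  have /eqaddoP/(_ e%:num) := diff_locally df; move=> /(_ [gt0 of e%:num]).
  have fgx := fg; rewrite (near_shift 0 x) subr0 in fg.
  apply: filterS2 fg => y /= fgy.
  by rewrite !fctE /= fgy (nbhs_singleton fgx).
apply/diff_locallyP; rewrite (diff_unique _ gE)//; last exact: diff_continuous.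
by split => //; exact: diff_continuous.
Qed.

(** Openness of [U] matters: it makes the derivatives of [f] and [g] agree on
    [U], and not only their values. *)
Lemma class_C_ext {W : normedModType R} k U (f g : 'rV[R]_n -> W) : open U ->
  (forall x, U x -> f x = g x) -> class_C k U f -> class_C k U g.
Proof.
move=> oU; elim: k f g => [|k IH] f g fg /=.
  move=> fc x Ux A; rewrite -(fg x Ux) => /(fc x Ux).
  apply: filterS2 (open_nbhs_nbhs _) => [y|]; last first.
    by split; [exact: oU|exact: Ux].
  by move=> /fg /= ->.
move=> [df dfC]; split=> [x Ux|v].
  apply: near_eq_differentiable (df x Ux).
  by near=> y; apply: fg; near: y; exact: open_nbhs_nbhs.
apply: IH (dfC v) => x Ux; apply: near_eq_derive.
by near=> y; apply: fg; near: y; exact: open_nbhs_nbhs.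
Unshelve. all: by end_near. Qed.

Lemma class_CS {W : normedModType R} k U (f : 'rV[R]_n -> W) :
  class_C k.+1 U f -> class_C k U f.
Proof.
elim: k f => [|k IH] f [df dfC]; last by split => // v; exact: IH.
by move=> x /df; exact: differentiable_continuous.
Qed.

Lemma class_C_cst {W : normedModType R} k U (w : W) : class_C k U (fun=> w).
Proof.
elim: k w => [|k IH] w; first by move=> x _; exact: cst_continuous.
split=> [x _|v]; first exact: differentiable_cst.
by rewrite (_ : 'D_v _ = fun=> 0)//; apply/funext => x; rewrite derive_cst.
Qed.

Lemma class_CD {W : normedModType R} k U (f g : 'rV[R]_n -> W) : open U ->
  class_C k U f -> class_C k U g -> class_C k U (f + g).
Proof.
move=> oU; elim: k f g => [|k IH] f g /=.
  by move=> fc gc x Ux; exact: continuousD (fc x Ux) (gc x Ux).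
move=> [df dfC] [dg dgC]; split=> [x Ux|v].
  by apply: differentiableD; [exact: df|exact: dg].
apply: class_C_ext (IH _ _ (dfC v) (dgC v)) => // x Ux.
by rewrite deriveD//; apply: diff_derivable; [exact: df|exact: dg].
Qed.

Lemma class_CM k U (f g : 'rV[R]_n -> R) : open U ->
  class_C k U f -> class_C k U g -> class_C k U (f * g).
Proof.
move=> oU; elim: k f g => [|k IH] f g /=.
  by move=> fc gc x Ux; exact: continuousM (fc x Ux) (gc x Ux).
move=> fC gC; have [[df dfC] [dg dgC]] := (fC, gC); split=> [x Ux|v].
  by apply: differentiableM; [exact: df|exact: dg].
apply: (@class_C_ext _ _ _ (f * 'D_v g + g * 'D_v f)) => // [x Ux|].
  by rewrite deriveM//; apply: diff_derivable; [exact: df|exact: dg].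
by apply: class_CD => //; apply: IH => //; exact: class_CS.
Qed.

Lemma class_C_coord k U p (f : 'rV[R]_n -> 'rV[R]_p) j : open U ->
  class_C k U f -> class_C k U (fun x => f x 0 j).
Proof.
move=> oU; elim: k f => [|k IH] f /=.
  move=> fc x Ux.
  apply: (@continuous_comp _ _ _ f (fun M : 'rV[R]_p => M 0 j)).
    exact: fc.
  exact: coord_continuous.
move=> [df dfC]; split=> [x Ux|v].
  apply: (@differentiable_comp _ _ _ _ f (fun M : 'rV[R]_p => M 0 j)).
    exact: df.
  exact: differentiable_coord.
apply: class_C_ext (IH _ (dfC v)) => // x Ux.
by rewrite derive_mx ?mxE//; apply: diff_derivable; exact: df.
Qed.

End SmoothClosure.

(** * Symmetry of second derivatives *)

Section Schwarz.
Context {R : realType} {V : normedModType R}.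
Implicit Types (f g : V -> R) (u v x y : V) (s t h : R).

Lemma is_derive_line g y v s d : is_derive (s *: v + y) v g d ->
  is_derive s 1 (fun r : R => g (r *: v + y)) d.
Proof.
have E : (fun h : R => h^-1 *: (((fun r : R => g (r *: v + y)) \o shift s) (h *: 1)
            - g (s *: v + y))) =
         (fun h : R => h^-1 *: ((g \o shift (s *: v + y)) (h *: v) - g (s *: v + y))).
  by apply/funext => h; rewrite /= [h *: 1]mulr1 scalerDl addrA.
by move=> [gd <-]; split; rewrite /derivable /derive E.
Qed.

Lemma is_derive_shift f y v z d : is_derive (y + z) v f d ->
  is_derive y v (fun w => f (w + z)) d.
Proof.
have E : (fun h : R => h^-1 *: (((fun w => f (w + z)) \o shift y) (h *: v)
            - f (y + z))) =
         (fun h : R => h^-1 *: ((f \o shift (y + z)) (h *: v) - f (y + z))).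
  by apply/funext => h; rewrite /= addrA.
by move=> [gd <-]; split; rewrite /derivable /derive E.
Qed.

Lemma MVT_line g (dg : R -> R) y v h : 0 < h ->
  (forall s, s \in `[0, h] -> is_derive (s *: v + y) v g (dg s)) ->
  exists2 s, s \in `[0, h] & g (h *: v + y) - g y = h * dg s.
Proof.
move=> h0 gd; pose G (s : R) := g (s *: v + y).
have Gd s : s \in `[0, h] -> is_derive s 1 G (dg s).
  by move=> /gd; exact: is_derive_line.
have Gc : {within `[0, h], continuous G}.
  by apply: derivable_within_continuous => s /Gd[].
have Gd' s : s \in `]0, h[ -> is_derive s 1 G (dg s).
  by rewrite in_itv/= => /andP[s0 sh]; apply: Gd; rewrite in_itv/= !ltW.
have [s sh] := MVT_segment (ltW h0) Gd' Gc.
by rewrite /G scale0r add0r subr0 mulrC; exists s.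
Qed.

(** The mean value theorem applied in the direction [u] to the increment of [f]
    in the direction [v], then in the direction [v] to ['D_u f]. The left-hand
    side is symmetric in [u] and [v], the right-hand side is not. *)
Lemma second_difference f u v x h : 0 < h ->
  (forall s t, s \in `[0, h] -> t \in `[0, h] ->
     differentiable f (s *: u + (t *: v + x)) /\
     differentiable ('D_u f) (t *: v + (s *: u + x))) ->
  exists s t, [/\ s \in `[0, h], t \in `[0, h] &
    f (h *: u + (h *: v + x)) - f (h *: u + x) - f (h *: v + x) + f x =
    h * (h * 'D_v ('D_u f) (t *: v + (s *: u + x)))].
Proof.
move=> h0 fd.
have hh : h \in `[0, h] by rewrite in_itv/= lexx (ltW h0).
have z0 : 0 \in `[0, h] by rewrite in_itv/= lexx (ltW h0).
pose g z := f (z + h *: v) - f z.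
have Duf r t : r \in `[0, h] -> t \in `[0, h] ->
    is_derive (t *: v + (r *: u + x)) u f ('D_u f (t *: v + (r *: u + x))).
  move=> rh th; apply/derivableP/diff_derivable; rewrite addrCA.
  by have [] := fd r t rh th.
have gd r : r \in `[0, h] -> is_derive (r *: u + x) u g
    ('D_u f (h *: v + (r *: u + x)) - 'D_u f (r *: u + x)).
  move=> rh; apply: (@is_deriveB _ _ _ (fun z => f (z + h *: v)) f).
  - by apply: is_derive_shift; rewrite addrC; exact: Duf.
  - by have := Duf r 0 rh z0; rewrite scale0r add0r.
have [s sh gE] := MVT_line h0 gd.
have Dd t : t \in `[0, h] -> is_derive (t *: v + (s *: u + x)) v ('D_u f)
    ('D_v ('D_u f) (t *: v + (s *: u + x))).
  by move=> th; apply/derivableP/diff_derivable; have [] := fd s t sh th.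
have [t th DE] := MVT_line h0 Dd.
exists s, t; split => //; rewrite -DE -gE /g.
rewrite (_ : h *: u + x + h *: v = h *: u + (h *: v + x)).
  by rewrite [x + h *: v]addrC; ring.
by rewrite -addrA [x + _]addrC.
Qed.

Lemma eq_of_near_eq (T : topologicalType) (p q : T -> R) (x : T) :
  {for x, continuous p} -> {for x, continuous q} ->
  (forall A, nbhs x A -> exists a b, [/\ A a, A b & p a = q b]) -> p x = q x.
Proof.
move=> pc qc pq; apply/eqP; rewrite -subr_eq0 -normr_le0.
apply/ler_addgt0Pl => e e0; rewrite addr0.
have e2 : 0 < e / 2 by rewrite divr_gt0.
move/cvgrPdist_lt/(_ _ e2): pc => pc; move/cvgrPdist_lt/(_ _ e2): qc => qc.
have [y [z [[yp _] [_ zq] pqE]]] := pq _ (filterI pc qc).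
rewrite (le_trans (ler_distD (p y) _ _))// [e]splitr lerD ?ltW// pqE distrC.
exact: zq.
Qed.

(** Exchanging the roles of [u] and [v] in [second_difference] gives, in any
    neighborhood of [x], two points at which the two iterated derivatives
    take the same value; continuity concludes. *)
Lemma Schwarz (U : set V) f u v x : open U -> U x ->
  (forall y, U y -> differentiable f y) ->
  (forall y, U y -> differentiable ('D_u f) y) ->
  (forall y, U y -> differentiable ('D_v f) y) ->
  {for x, continuous ('D_v ('D_u f))} -> {for x, continuous ('D_u ('D_v f))} ->
  'D_v ('D_u f) x = 'D_u ('D_v f) x.
Proof.
move=> oU Ux fd fud fvd cvu cuv.
apply: (@eq_of_near_eq _ ('D_v ('D_u f)) ('D_u ('D_v f)) x cvu cuv) => A Ax.
have : nbhs x (U `&` A) by apply: filterI => //; exact: open_nbhs_nbhs.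
move=> /nbhs_ballP[d /= d0 dP].
(* [h] is such that the parallelogram at [x] with sides [h *: u] and [h *: v]
   lies in the ball of radius [d]; adding 1 avoids dividing by zero. *)
pose k := `|u| + `|v| + 1; have k0 : 0 < k by rewrite ltr_wpDl// addr_ge0.
pose h := d / k / 2; have h0 : 0 < h by rewrite !divr_gt0.
have inU s t : s \in `[0, h] -> t \in `[0, h] -> ball x d (s *: u + (t *: v + x)).
  rewrite !in_itv/= => /andP[s0 sh] /andP[t0 th].
  rewrite -ball_normE/= addrA opprD addrCA subrr addr0 normrN.
  rewrite (le_lt_trans (ler_normD _ _))// !normrZ !ger0_norm//.
  apply: (@le_lt_trans _ _ (h * k)).
    rewrite /k !mulrDr -addrA lerD ?ler_wpM2r//.
    by rewrite ler_wpDr ?mulr1 ?(ltW h0)// ler_wpM2r.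
  by rewrite /h mulrAC divfK ?gt_eqF// ltr_pdivrMr// ltr_pMr// ltr1n.
have [s1 [t1 [s1h t1h E1]]] : exists s t, [/\ s \in `[0, h], t \in `[0, h] &
    f (h *: u + (h *: v + x)) - f (h *: u + x) - f (h *: v + x) + f x =
    h * (h * 'D_v ('D_u f) (t *: v + (s *: u + x)))].
  apply: second_difference => // s t sh th.
  split; first by apply: fd; have [] := dP _ (inU s t sh th).
  by rewrite addrCA; apply: fud; have [] := dP _ (inU s t sh th).
have [t2 [s2 [t2h s2h E2]]] : exists s t, [/\ s \in `[0, h], t \in `[0, h] &
    f (h *: v + (h *: u + x)) - f (h *: v + x) - f (h *: u + x) + f x =
    h * (h * 'D_u ('D_v f) (t *: u + (s *: v + x)))].
  apply: second_difference => // s t sh th; rewrite addrCA.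
  split; first by apply: fd; have [] := dP _ (inU t s th sh).
  by apply: fvd; have [] := dP _ (inU t s th sh).
have E : 'D_v ('D_u f) (t1 *: v + (s1 *: u + x)) =
    'D_u ('D_v f) (s2 *: u + (t2 *: v + x)).
  have mulhI (r1 r2 : R) : h * (h * r1) = h * (h * r2) -> r1 = r2.
    by move=> /(mulfI (lt0r_neq0 h0))/(mulfI (lt0r_neq0 h0)).
  apply: mulhI; apply: etrans (esym E1) (etrans _ E2).
  by rewrite [h *: v + (_ + _)]addrCA; ring.
exists (t1 *: v + (s1 *: u + x)), (s2 *: u + (t2 *: v + x)); split; last exact: E.
- by rewrite addrCA; have [] := dP _ (inU _ _ s1h t1h).
- by have [] := dP _ (inU _ _ s2h t2h).
Qed.

End Schwarz.

Lemma class_C_Schwarz {R : realType} {n : nat} (U : set 'rV[R]_n)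
    (f : 'rV[R]_n -> R) u v x :
  open U -> U x -> class_C 2 U f -> 'D_u ('D_v f) x = 'D_v ('D_u f) x.
Proof.
move=> oU Ux [df dfC]; apply: (Schwarz oU Ux df).
- by have [] := dfC v.
- by have [] := dfC u.
- by have [_ /(_ u x Ux)] := dfC v.
- by have [_ /(_ v x Ux)] := dfC u.
Qed.

(** * Operations on differential forms *)

Section FormOperations.
Context {R : realType} {n : nat} {M : smooth_manifold R n}.
Local Notation chart_at i := (atlas (s := M) i).
Implicit Types (i j : atlas_index M) (p : M) (x : 'rV[R]_n).

Definition coords i : set 'rV[R]_n := chart_map (chart_at i) @` cdom (chart_at i).

Definition overlap i j : set 'rV[R]_n :=
  chart_map (chart_at i) @` (cdom (chart_at i) `&` cdom (chart_at j)).

Lemma open_coords i : open (coords i).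
Proof. exact: open_ccod. Qed.

Lemma coords_map i p : cdom (chart_at i) p -> coords i (chart_map (chart_at i) p).
Proof. by exists p. Qed.

(** The image of an open subset of the domain of a chart is open because, near
    a point of the image, it is the preimage of that subset by the inverse of
    the chart. *)
Lemma open_overlap i j : open (overlap i j).
Proof.
rewrite openE => _ [p [pi pj] <-].
have inv_j : \forall y \near chart_map (chart_at i) p,
    cdom (chart_at j) (chart_inv (chart_at i) y).
  apply: (chart_inv_continuous pi); rewrite chartK//.
  by apply: open_nbhs_nbhs; split => //; exact: open_cdom.
have in_i : \forall y \near chart_map (chart_at i) p, coords i y.
  by apply: open_nbhs_nbhs; split; [exact: open_coords|exact: coords_map].
apply: filterS2 inv_j in_i => y yj [q qi qy]; exists q => //; split => //.
by move: yj; rewrite -qy chartK.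
Qed.

Lemma transition_map i j p : cdom (chart_at i) p ->
  transition (chart_at i) (chart_at j) (chart_map (chart_at i) p) =
  chart_map (chart_at j) p.
Proof. by move=> pi; rewrite /transition /= chartK. Qed.

Lemma row'01 (V : 'M[R]_(2, n)) : row' 0 V = row 1 V.
Proof. by apply/rowP => k; rewrite !mxE; congr (V _ k); apply/val_inj. Qed.

Lemma row'10 (V : 'M[R]_(2, n)) : row' 1 V = row 0 V.
Proof. by apply/rowP => k; rewrite !mxE; congr (V _ k); apply/val_inj. Qed.

Lemma ext_d1E (w : local_form M 1) i x V :
  ext_d w i x V = 'D_(row 0 V) (fun y => w i y (row 1 V)) x -
                  'D_(row 1 V) (fun y => w i y (row 0 V)) x.
Proof.
rewrite /ext_d big_ord_recl big_ord1 expr0 expr1 mul1r mulN1r.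
rewrite (_ : lift ord0 ord0 = 1 :> 'I_2); last exact/val_inj.
by rewrite row'01 row'10.
Qed.

Lemma ext_d2E (w : local_form M 2) i x V :
  ext_d w i x V =
    'D_(row 0 V) (fun y => w i y (col_mx (row 1 V) (row (2 : 'I_3) V))) x -
    'D_(row 1 V) (fun y => w i y (col_mx (row 0 V) (row (2 : 'I_3) V))) x +
    'D_(row (2 : 'I_3) V) (fun y => w i y (col_mx (row 0 V) (row 1 V))) x.
Proof.
rewrite /ext_d !big_ord_recl big_ord0 addr0 expr0 expr1 expr2 !mul1r mulN1r.
rewrite (_ : lift ord0 ord0 = 1 :> 'I_3); last exact/val_inj.
rewrite (_ : lift ord0 _ = 2 :> 'I_3); last exact/val_inj.
have rE (r s t : 'I_3) : lift r 0 = s -> lift r 1 = t ->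
    row' r V = col_mx (row s V) (row t V).
  move=> <- <-; rewrite [LHS]row2E.
  have rowE q : row q (row' r V) = row (lift r q) V.
    by apply/rowP => k; rewrite !mxE.
  by rewrite !rowE.
rewrite (rE 0 1 2) ?(rE 1 0 2) ?(rE 2 0 1); try exact/val_inj.
by rewrite mulN1r opprK mul1r addrA.
Qed.

Lemma is_form_add k (w e : local_form M k) :
  is_form w -> is_form e -> is_form (form_add w e).
Proof.
move=> [wl wa ws wc] [el ea es ec]; split.
- by move=> i p pi; apply: multilinearD; [exact: wl|exact: el].
- move=> i p pi A r s rs Ars.
  by rewrite /form_add (wa i p pi A r s)// (ea i p pi A r s)// addr0.
- by move=> i V m; apply: class_CD; [exact: open_coords|exact: ws|exact: es].
- by move=> i j p V pi pj; rewrite /form_add (wc i j)// (ec i j).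
Qed.

Lemma is_form_scale k c (w : local_form M k) :
  is_form w -> is_form (form_scale c w).
Proof.
move=> [wl wa ws wc]; split.
- by move=> i p pi; apply: multilinearZ; exact: wl.
- by move=> i p pi A r s rs Ars; rewrite /form_scale (wa i p pi A r s)// mulr0.
- move=> i V m; apply: class_CM; [exact: open_coords|exact: class_C_cst|exact: ws].
- by move=> i j p V pi pj; rewrite /form_scale (wc i j).
Qed.

Lemma class_C_sum m (U : set 'rV[R]_n) (I : finType) (f : I -> 'rV[R]_n -> R) :
  open U -> (forall t, class_C m U (f t)) -> class_C m U (fun x => \sum_t f t x).
Proof.
move=> oU fC; rewrite -(_ : \sum_t f t = fun x => \sum_t f t x); last first.
  by apply/funext => x; rewrite fct_sumE.
apply: (big_ind (class_C m U)) => //; first exact: class_C_cst.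
by move=> g h; exact: class_CD.
Qed.

Lemma is_form_wedge k l (w : local_form M k) (e : local_form M l) :
  is_form w -> is_form e -> is_form (form_wedge w e).
Proof.
move=> [wl wa ws wc] [el ea es ec]; split.
- by move=> i p pi; apply: wedge_multilinear; [exact: wl|exact: el].
- by move=> i p pi; exact: wedge_alternating.
- move=> i V m; have oi := @open_coords i.
  apply: class_CM => //; first exact: class_C_cst.
  apply: class_C_sum => // s.
  apply: class_CM => //; first exact: class_C_cst.
  by apply: class_CM => //; [exact: ws|exact: es].
- move=> i j p V pi pj; congr (_ * _); apply: eq_bigr => s _.
  rewrite (wc i j p)// (ec i j p)//; congr (_ * (w _ _ _ * e _ _ _)).
  + by apply/row_matrixP => r; rewrite row_mul !row_usubmx !row_row_perm row_mul.
  + by apply/row_matrixP => r; rewrite row_mul !row_dsubmx !row_row_perm row_mul.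
Qed.

End FormOperations.

Section BilinearRows.
Context {R : realType} {n : nat}.

Lemma row0_col_mx (u v : 'rV[R]_n) :
  row (0 : 'I_2) (col_mx u v : 'M[R]_(1 + 1, n)) = u.
Proof.
transitivity (row (lshift 1 0) (col_mx u v)); first by congr row; exact/val_inj.
by rewrite -row_usubmx col_mxKu row_id.
Qed.

Lemma row1_col_mx (u v : 'rV[R]_n) :
  row (1 : 'I_2) (col_mx u v : 'M[R]_(1 + 1, n)) = v.
Proof.
transitivity (row (rshift 1 0) (col_mx u v)); first by congr row; exact/val_inj.
by rewrite -row_dsubmx col_mxKd row_id.
Qed.

Lemma ord2P (t : 'I_2) : t = 0 \/ t = 1.
Proof. by case: t => -[|[|//]] t_lt; [left|right]; apply/val_inj. Qed.

Lemma bilinear_multilinear_rows (P : 'rV[R]_n -> 'rV[R]_n -> R) :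
  (forall v, multilinear_rows (P ^~ v)) -> (forall u, multilinear_rows (P u)) ->
  multilinear_rows (fun V : 'M[R]_(2, n) => P (row 0 V) (row 1 V)).
Proof.
move=> Pl Pr A B C r b c Ar Br Cr.
have [rE|rE] : r = 0 \/ r = 1.
- exact: ord2P.
- have {}Br : row 1 B = row 1 A by apply: (row'_row Br); rewrite rE.
  have {}Cr : row 1 C = row 1 A by apply: (row'_row Cr); rewrite rE.
  by rewrite -rE Ar Br Cr (multilinear1P (Pl _)).
- have {}Br : row 0 B = row 0 A by apply: (row'_row Br); rewrite rE.
  have {}Cr : row 0 C = row 0 A by apply: (row'_row Cr); rewrite rE.
  by rewrite -rE Ar Br Cr (multilinear1P (Pr _)).
Qed.

Lemma antisym_alternating_rows (P : 'rV[R]_n -> 'rV[R]_n -> R) :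
  alternating_rows
    (fun V : 'M[R]_(2, n) => P (row 0 V) (row 1 V) - P (row 1 V) (row 0 V)).
Proof.
move=> A r s rs Ars; suff -> : row 0 A = row 1 A by rewrite addrN.
by case: (ord2P r) (ord2P s) rs Ars => -> [] ->.
Qed.

End BilinearRows.

(** * The exterior derivative of a 1-form *)

Section ExteriorDerivative.
Context {R : realType} {n : nat} {M : smooth_manifold R n}.
Local Notation chart_at i := (atlas (s := M) i).
Implicit Types (i j : atlas_index M) (p : M) (x : 'rV[R]_n).
Variables (w : local_form M 1) (w_form : is_form w).

Lemma form_differentiable i v x : coords i x -> differentiable (fun y => w i y v) x.
Proof. by move=> xi; have [] := form_smooth w_form i v 1%N; move=> /(_ x xi). Qed.

Lemma form_derivable i u v x : coords i x -> derivable (fun y => w i y v) x u.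
Proof. by move=> xi; exact/diff_derivable/form_differentiable. Qed.

Lemma derive_form_linearl i v x : coords i x ->
  multilinear_rows (fun u : 'rV[R]_n => 'D_u (fun y => w i y v) x).
Proof.
move=> xi A B C r b c; rewrite (ord1 r) !row_id => -> _ _.
by rewrite !deriveE ?linearD ?linearZ//; exact: form_differentiable.
Qed.

(** Linearity of [w i y] is only known for [y] in the image of the chart, which
    is enough because it is open. *)
Lemma derive_form_linearr i u x : coords i x ->
  multilinear_rows (fun v : 'rV[R]_n => 'D_u (fun y => w i y v) x).
Proof.
move=> xi A B C r b c; rewrite (ord1 r) !row_id => AE _ _.
have E : \forall y \near x, w i y A =
    (b \*: (fun y => w i y B) + c \*: (fun y => w i y C)) y.
  have : \forall y \near x, coords i y.
    by apply: open_nbhs_nbhs; split => //; exact: open_coords.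
  apply: filterS => _ [p pi <-].
  by rewrite AE (multilinear1P (form_multilinear w_form pi)).
rewrite (near_eq_derive _ E) deriveD; [|exact/derivableZ/form_derivable..].
by rewrite !deriveZ//; exact: form_derivable.
Qed.

Lemma ext_d_multilinear i p : cdom (chart_at i) p ->
  multilinear_rows (ext_d w i (chart_map (chart_at i) p)).
Proof.
move=> pi; have xi := coords_map pi.
set x := chart_map _ p.
rewrite (_ : ext_d w i x = fun V => 'D_(row 0 V) (fun y => w i y (row 1 V)) x +
  -1 * 'D_(row 1 V) (fun y => w i y (row 0 V)) x); last first.
  by apply/funext => V; rewrite ext_d1E mulN1r.
apply: multilinearD; last apply: multilinearZ.
- apply: (@bilinear_multilinear_rows _ _ (fun u v => 'D_u (fun y => w i y v) _)) => u.
  + exact: derive_form_linearl.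
  + exact: derive_form_linearr.
- apply: (@bilinear_multilinear_rows _ _ (fun u v => 'D_v (fun y => w i y u) _)) => u.
  + exact: derive_form_linearr.
  + exact: derive_form_linearl.
Qed.

Lemma ext_d_alternating i x : alternating_rows (ext_d w i x).
Proof.
rewrite (_ : ext_d w i _ = fun V => 'D_(row 0 V) (fun y => w i y (row 1 V)) x -
  'D_(row 1 V) (fun y => w i y (row 0 V)) x); last first.
  by apply/funext => V; rewrite ext_d1E.
exact: (antisym_alternating_rows (fun u v => 'D_u (fun y => w i y v) x)).
Qed.

Lemma ext_d_smooth i V : smooth_on (coords i) (fun x => ext_d w i x V).
Proof.
move=> k; rewrite (_ : (fun x => _) = 'D_(row 0 V) (fun y => w i y (row 1 V)) +
  (cst (-1)) * 'D_(row 1 V) (fun y => w i y (row 0 V))); last first.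
  by apply/funext => x; rewrite ext_d1E !fctE mulN1r.
have dC u v : class_C k (coords i) ('D_u (fun y => w i y v)).
  by have [_] := form_smooth w_form i v k.+1; exact.
have oi := @open_coords _ _ _ i.
apply: class_CD => //; apply: class_CM => //; exact: class_C_cst.
Qed.

End ExteriorDerivative.

Lemma subr_addr_sum (R : realType) (I : finType) (P Q : R) (s t c : I -> R) :
  s =1 t -> P + \sum_i s i * c i - (Q + \sum_i t i * c i) = P - Q.
Proof.
move=> st; rewrite (eq_bigr (fun i => t i * c i)) => [|i _]; last by rewrite st.
by rewrite opprD addrACA addrN addr0.
Qed.

(** * Independence of the exterior derivative from the chart *)

Section ChangeOfCoordinates.
Context {R : realType} {n : nat} {M : smooth_manifold R n}.
Local Notation chart_at i := (atlas (s := M) i).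
Implicit Types (i j : atlas_index M) (p : M) (x : 'rV[R]_n).
Local Notation T i j := (transition (chart_at i) (chart_at j)).

Lemma overlap_map i j p : cdom (chart_at i) p -> cdom (chart_at j) p ->
  overlap i j (chart_map (chart_at i) p).
Proof. by exists p. Qed.

Lemma transition_differentiable i j x : overlap i j x -> differentiable (T i j) x.
Proof. by have [+ _] := atlas_smooth i j 1%N; apply. Qed.

(** [deriveEjacobian] from right to left, with scalars in a [realType] so that
    its pattern is found syntactically. *)
Lemma mul_jacobian (f : 'rV[R]_n -> 'rV[R]_n) x v :
  differentiable f x -> v *m jacobian f x = 'D_v f x.
Proof. by move=> fd; rewrite deriveEjacobian. Qed.

Lemma derive_comp {W : normedModType R} (f : 'rV[R]_n -> 'rV[R]_n)
    (g : 'rV[R]_n -> W) u x :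
  differentiable f x -> differentiable g (f x) ->
  'D_u (g \o f) x = 'D_('D_u f x) g (f x).
Proof.
move=> fd gd; rewrite deriveE; last exact: differentiable_comp.
by rewrite diff_comp//= !deriveE.
Qed.

Lemma transition_jacobianK i j p : cdom (chart_at i) p -> cdom (chart_at j) p ->
  jacobian (T i j) (chart_map (chart_at i) p) *m
  jacobian (T j i) (chart_map (chart_at j) p) = 1%:M.
Proof.
move=> pi pj; set x := chart_map _ p.
have xij : overlap i j x by exact: overlap_map.
have Tx : T i j x = chart_map (chart_at j) p by exact: transition_map.
have dij : differentiable (T i j) x by exact: transition_differentiable.
have dji : differentiable (T j i) (chart_map (chart_at j) p).
  by apply: transition_differentiable; exact: overlap_map.
have TK : \forall y \near x, (T j i \o T i j) y = id y.
  have : \forall y \near x, overlap i j y.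
    by apply: open_nbhs_nbhs; split => //; exact: open_overlap.
  apply: filterS => _ [q [qi qj] <-].
  by rewrite /= transition_map// transition_map.
have TD (u : 'rV[R]_n) : 'D_u (T j i \o T i j) x = u.
  by rewrite (near_eq_derive _ TK); exact: derive_id.
have JK (u : 'rV[R]_n) : u *m jacobian (T i j) x *m
    jacobian (T j i) (chart_map (chart_at j) p) = u.
  rewrite (mul_jacobian _ dji) (mul_jacobian _ dij) -Tx.
  by rewrite -derive_comp// Tx.
by apply/row_matrixP => k; rewrite !rowE mulmxA JK mulmx1.
Qed.

Variables (w : local_form M 1) (w_form : is_form w).

(** The coordinates of the image of a constant vector [v] under the transition
    map are the derivatives of the components of this map along [v]. This form
    of the compatibility between charts can be differentiated. *)
Lemma form_pullback i j p v : cdom (chart_at i) p -> cdom (chart_at j) p ->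
  \forall y \near chart_map (chart_at i) p, w i y v =
    \sum_k 'D_v (fun z => T i j z 0 k) y * w j (T i j y) (delta_mx 0 k).
Proof.
move=> pi pj.
have : \forall y \near chart_map (chart_at i) p, overlap i j y.
  by apply: open_nbhs_nbhs; split; [exact: open_overlap|exact: overlap_map].
apply: filterS => _ [q [qi qj] <-].
have qij := overlap_map qi qj.
have dT := transition_differentiable qij.
rewrite (form_compat w_form v qi qj) mul_jacobian//.
rewrite (one_form_colE _ (form_multilinear w_form qj)) mxE.
apply: eq_bigr => k _; rewrite transition_map// mxE; congr (_ * _).
by rewrite derive_mx ?mxE//; exact: diff_derivable.
Qed.

(** Besides the expected term there is a sum of second derivatives of the
    transition map, which is symmetric in [u] and [v] and will cancel in the
    exterior derivative. *)
Lemma derive_form_change i j p u v : cdom (chart_at i) p -> cdom (chart_at j) p ->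
  let x := chart_map (chart_at i) p in
  'D_u (fun y => w i y v) x =
    'D_('D_u (T i j) x) (fun y => w j y ('D_v (T i j) x)) (T i j x) +
    \sum_k 'D_u ('D_v (fun z => T i j z 0 k)) x * w j (T i j x) (delta_mx 0 k).
Proof.
move=> pi pj x.
have xij : overlap i j x by exact: overlap_map.
have dT := transition_differentiable xij.
have Tx : T i j x = chart_map (chart_at j) p by exact: transition_map.
have Txj : coords j (T i j x) by rewrite Tx; exact: coords_map.
have wd v' : differentiable (fun y => w j y v') (T i j x).
  exact: form_differentiable.
have TC m k : class_C m (overlap i j) (fun z => T i j z 0 k).
  by apply: class_C_coord; [exact: open_overlap|exact: atlas_smooth].
have DTd k : derivable ('D_v (fun z => T i j z 0 k)) x u.
  by have [_ /(_ v)[/(_ x xij)/diff_derivable + _]] := TC 2%N k; apply.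
have wTd k : derivable ((fun y => w j y (delta_mx 0 k)) \o T i j) x u.
  by apply/diff_derivable/differentiable_comp.
rewrite (near_eq_derive _ (form_pullback v pi pj)).
rewrite -(_ : \sum_k ('D_v (fun z => T i j z 0 k) *
       ((fun y => w j y (delta_mx 0 k)) \o T i j)) =
     fun y => \sum_k 'D_v (fun z => T i j z 0 k) y *
       w j (T i j y) (delta_mx 0 k)); last first.
  by apply/funext => y; rewrite fct_sumE.
rewrite derive_sum => [|k]; last exact: derivableM.
rewrite (one_form_colE _ (derive_form_linearr w_form ('D_u (T i j) x) Txj)) mxE.
rewrite -big_split/=; apply: eq_bigr => k _; rewrite deriveM// derive_comp//.
rewrite mxE; congr (_ + _); last by rewrite mulrC.
by congr (_ * _); rewrite derive_mx ?mxE//; exact: diff_derivable.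
Qed.

Lemma ext_d_compat i j p V : cdom (chart_at i) p -> cdom (chart_at j) p ->
  ext_d w i (chart_map (chart_at i) p) V =
  ext_d w j (chart_map (chart_at j) p)
    (V *m jacobian (T i j) (chart_map (chart_at i) p)).
Proof.
move=> pi pj; have pij := overlap_map pi pj; have oij := @open_overlap _ _ _ i j.
have dT := transition_differentiable pij.
have sym k : let x := chart_map (chart_at i) p in
    'D_(row 0 V) ('D_(row 1 V) (fun z => T i j z 0 k)) x =
    'D_(row 1 V) ('D_(row 0 V) (fun z => T i j z 0 k)) x.
  apply: (class_C_Schwarz _ _ oij pij).
  by apply: class_C_coord => //; exact: atlas_smooth.
rewrite !ext_d1E !row_mul !mul_jacobian// -(transition_map j pi).
rewrite (derive_form_change (row 0 V) (row 1 V) pi pj).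
rewrite (derive_form_change (row 1 V) (row 0 V) pi pj).
exact: subr_addr_sum sym.
Qed.

Lemma is_form_ext_d : is_form (ext_d w).
Proof.
split.
- by move=> i p; exact: ext_d_multilinear.
- by move=> i p _; exact: ext_d_alternating.
- by move=> i V; exact: ext_d_smooth.
- by move=> i j p V; exact: ext_d_compat.
Qed.

End ChangeOfCoordinates.

(** * The Lee form of d alpha + c (alpha /\ beta) *)

Section LeeForm.

(** The equation [d omega = omega /\ c beta] once all derivatives are expanded:
    [f], [g] stand for the values of [alpha] and [beta] on constant vector
    fields, [Df], [Dg] and [DDf] for their first and second derivatives along
    such fields. The symmetry of [DDf] gives [d d alpha = 0], and that of
    [Dg] is [d beta = 0]. *)
Lemma lee_identity (R : realType) (S : Type) (c : R) (f g : S -> R)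
    (Df Dg : S -> S -> R) (DDf : S -> S -> S -> R) :
  (forall a b d, DDf a b d = DDf b a d) -> (forall a b, Dg a b = Dg b a) ->
  let om a b := Df a b - Df b a + c * (f a * g b - f b * g a) in
  let Dom a b d := DDf a b d - DDf a d b +
    c * ((f b * Dg a d + g d * Df a b) - (f d * Dg a b + g b * Df a d)) in
  forall a b d, Dom a b d - Dom b a d + Dom d a b =
    om a b * (c * g d) - om a d * (c * g b) + om b d * (c * g a).
Proof.
move=> DDC DC om Dom a b d; rewrite /Dom /om.
rewrite (DDC b a d) (DDC d a b) (DDC d b a) (DC b a) (DC d a) (DC d b).
by ring.
Qed.

Context {R : realType} {n : nat} {M : smooth_manifold R n}.
Local Notation chart_at i := (atlas (s := M) i).
Implicit Types (i j : atlas_index M) (p : M) (x : 'rV[R]_n).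
Variables (alpha beta : local_form M 1).
Hypotheses (alpha_form : is_form alpha) (beta_form : is_form beta)
  (beta_closed : closed_form beta).
Variable c : R.
Local Notation omega :=
  (form_add (ext_d alpha) (form_scale c (form_wedge alpha beta))).

Lemma omegaE i x (u v : 'rV[R]_n) :
  omega i x (col_mx u v) =
    'D_u (fun y => alpha i y v) x - 'D_v (fun y => alpha i y u) x +
    c * (alpha i x u * beta i x v - alpha i x v * beta i x u).
Proof.
by rewrite /form_add /form_scale ext_d1E wedge11E !row0_col_mx !row1_col_mx.
Qed.

Lemma is_form_omega : is_form omega.
Proof.
apply: is_form_add; first exact: is_form_ext_d.
by apply: is_form_scale; exact: (is_form_wedge alpha_form beta_form).
Qed.

Lemma closed_form1C i p u v : cdom (chart_at i) p ->
  'D_u (fun y => beta i y v) (chart_map (chart_at i) p) =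
  'D_v (fun y => beta i y u) (chart_map (chart_at i) p).
Proof.
move=> pi; have := beta_closed (col_mx u v : 'M[R]_(1 + 1, n)) pi.
by rewrite ext_d1E row0_col_mx row1_col_mx => /eqP; rewrite subr_eq0 => /eqP.
Qed.

Lemma form_smooth2 i v : class_C 2 (coords i) (fun y => alpha i y v).
Proof. exact: (form_smooth alpha_form). Qed.

Lemma derive_omega i x (z u v : 'rV[R]_n) : coords i x ->
  'D_z (fun y => omega i y (col_mx u v)) x =
    'D_z ('D_u (fun y => alpha i y v)) x - 'D_z ('D_v (fun y => alpha i y u)) x +
    c * ((alpha i x u * 'D_z (fun y => beta i y v) x +
          beta i x v * 'D_z (fun y => alpha i y u) x) -
         (alpha i x v * 'D_z (fun y => beta i y u) x +
          beta i x u * 'D_z (fun y => alpha i y v) x)).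
Proof.
move=> xi.
have ad u' : derivable (fun y => alpha i y u') x z by exact: form_derivable.
have bd u' : derivable (fun y => beta i y u') x z by exact: form_derivable.
have add u' v' : derivable ('D_u' (fun y => alpha i y v')) x z.
  have [_ /(_ u')[+ _]] := form_smooth2 i v'.
  by move=> /(_ x xi)/diff_derivable.
rewrite (_ : (fun y => _) =
   ('D_u (fun y => alpha i y v) - 'D_v (fun y => alpha i y u)) +
   c \*: ((fun y => alpha i y u) * (fun y => beta i y v) -
          (fun y => alpha i y v) * (fun y => beta i y u))); last first.
  by apply/funext => y; rewrite omegaE.
have ab u' v' := derivableM (ad u') (bd v').
rewrite deriveD; [|exact: derivableB|by apply: derivableZ; exact: derivableB].
rewrite deriveB// deriveZ; last exact: derivableB.
by rewrite deriveB// !deriveM.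
Qed.

Lemma ext_d_omega : form_eq (ext_d omega) (form_wedge omega (form_scale c beta)).
Proof.
move=> i p V pi; have xi := coords_map pi; have oi := @open_coords _ _ M i.
have omf := is_form_omega.
rewrite ext_d2E wedge21E;
  [|exact: (form_multilinear omf pi)|exact: (form_alternating omf pi)].
rewrite !derive_omega// !omegaE.
have sym a b d : 'D_a ('D_b (fun y => alpha i y d)) (chart_map (chart_at i) p) =
    'D_b ('D_a (fun y => alpha i y d)) (chart_map (chart_at i) p).
  exact: (class_C_Schwarz _ _ oi xi (form_smooth2 i d)).
exact: (lee_identity c (alpha i (chart_map (chart_at i) p))
  (beta i (chart_map (chart_at i) p)) (fun a b => 'D_a (fun y => alpha i y b) _)
  sym (fun a b => closed_form1C a b pi)).
Qed.

Lemma closed_form_scale : closed_form (form_scale c beta).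
Proof.
move=> i p V pi; have xi := coords_map pi.
have E u v : 'D_u (fun y => form_scale c beta i y v) (chart_map (chart_at i) p) =
    c * 'D_u (fun y => beta i y v) (chart_map (chart_at i) p).
  by apply: deriveZ; exact: form_derivable.
by rewrite ext_d1E !E (closed_form1C _ _ pi) addrN.
Qed.

Lemma is_lee_form_omega : is_lee_form omega (form_scale c beta).
Proof.
split; [exact: is_form_scale|exact: closed_form_scale|exact: ext_d_omega].
Qed.

End LeeForm.

(** * Nondegeneracy for large c *)

Section ContinuityOfDeterminants.
Context {R : realType} {T : Type} {F : set_system T} {FF : Filter F}.

Lemma cvg_det m (A_ : T -> 'M[R]_m) (A : 'M[R]_m) :
  (forall k l, A_ z k l @[z --> F] --> A k l) ->
  \det (A_ z) @[z --> F] --> \det A.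
Proof.
move=> Acvg; apply: (@cvg_big _ _ +%R) => [|s _]; first exact: add_continuous.
apply: cvgM; first exact: cvg_cst.
have mulC : continuous (fun z : R * R => z.1 * z.2) by exact: mul_continuous.
have := @cvg_big R _ _ 1 xpredT mulC _ F (index_enum 'I_m)
  (fun i z => A_ z i (s i)) (fun i => A i (s i)) FF.
by apply => k _; exact: Acvg.
Qed.

Lemma cvg_bordered_mx n (B_ : T -> 'M[R]_(1 + 1, n) -> R)
    (B : 'M[R]_(1 + 1, n) -> R) (f_ g_ : T -> 'rV[R]_n -> R)
    (f g : 'rV[R]_n -> R) (t_ : T -> R) (t : R) :
  (forall V, B_ z V @[z --> F] --> B V) ->
  (forall v, f_ z v @[z --> F] --> f v) ->
  (forall v, g_ z v @[z --> F] --> g v) ->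
  t_ z @[z --> F] --> t ->
  forall k l, bordered_mx (B_ z) (f_ z) (g_ z) (t_ z) k l @[z --> F] -->
    bordered_mx B f g t k l.
Proof.
move=> Bc fc gc tc k l; rewrite /bordered_mx.
have [k' ->|k' ->] := split_ordP k; have [l' ->|l' ->] := split_ordP l.
- under eq_cvg do rewrite block_mxEul mxE; rewrite block_mxEul mxE; exact: Bc.
- have [m ->|m ->] := split_ordP l'.
  + by under eq_cvg do rewrite block_mxEur row_mxEl mxE;
      rewrite block_mxEur row_mxEl mxE; exact: fc.
  + by under eq_cvg do rewrite block_mxEur row_mxEr mxE;
      rewrite block_mxEur row_mxEr mxE; exact: gc.
- have [m ->|m ->] := split_ordP k'.
  + by under eq_cvg do rewrite block_mxEdl col_mxEu !mxE;
      rewrite block_mxEdl col_mxEu !mxE; exact: fc.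
  + by under eq_cvg do rewrite block_mxEdl col_mxEd !mxE;
      rewrite block_mxEdl col_mxEd !mxE; exact: gc.
- have [r ->|r ->] := split_ordP k'; have [s ->|s ->] := split_ordP l'.
  + by under eq_cvg do rewrite block_mxEdr block_mxEul mxE;
      rewrite block_mxEdr block_mxEul mxE; exact: cvg_cst.
  + have E a : a%:M r s = a :> R.
      by rewrite (ord1 r) (ord1 s) mxE eqxx mulr1n.
    by under eq_cvg do rewrite block_mxEdr block_mxEur E;
      rewrite block_mxEdr block_mxEur E; exact: tc.
  + have E a : (- a)%:M r s = - a :> R.
      by rewrite (ord1 r) (ord1 s) mxE eqxx mulr1n.
    by under eq_cvg do rewrite block_mxEdr block_mxEdl E;
      rewrite block_mxEdr block_mxEdl E; exact: (cvgN tc).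
  + by under eq_cvg do rewrite block_mxEdr block_mxEdr mxE;
      rewrite block_mxEdr block_mxEdr mxE; exact: cvg_cst.
Qed.

End ContinuityOfDeterminants.

Section Nondegeneracy.
Context {R : realType} {n : nat} {M : smooth_manifold R n}.
Local Notation chart_at i := (atlas (s := M) i).
Implicit Types (i j : atlas_index M) (p q : M) (x : 'rV[R]_n).

Definition nondegenerate_at (w : local_form M 2) i x :=
  forall u : 'rV[R]_n, (forall v : 'rV[R]_n, w i x (col_mx u v) = 0) -> u = 0.

(** The Jacobian of a transition map is invertible, so it identifies the
    radicals of the two local expressions. *)
Lemma nondegenerate_change (w : local_form M 2) i j p :
  is_form w -> cdom (chart_at i) p -> cdom (chart_at j) p ->
  nondegenerate_at w i (chart_map (chart_at i) p) ->
  nondegenerate_at w j (chart_map (chart_at j) p).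
Proof.
move=> wf pi pj wi u wu.
suff uJ : u *m jacobian (transition (chart_at j) (chart_at i))
                        (chart_map (chart_at j) p) = 0.
  by rewrite -[u]mulmx1 -(transition_jacobianK pj pi) mulmxA uJ mul0mx.
apply: wi => v.
have := wu (v *m jacobian (transition (chart_at i) (chart_at j))
                          (chart_map (chart_at i) p)).
rewrite (form_compat wf _ pj pi) => wuv; rewrite -[RHS]wuv; congr (w i _ _).
by rewrite [RHS](@mul_col_mx _ 1 1) -mulmxA transition_jacobianK// mulmx1.
Qed.

Lemma form_continuous k (w : local_form M k) i p V : is_form w ->
  cdom (chart_at i) p ->
  w i (chart_map (chart_at i) q) V @[q --> p] --> w i (chart_map (chart_at i) p) V.
Proof.
move=> wf pi.
apply: (@continuous_comp _ _ _ (chart_map (chart_at i)) (fun x => w i x V)).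
  exact: chart_continuous.
by have := form_smooth wf i V 0%N; apply; exact: coords_map.
Qed.

End Nondegeneracy.

Section LargeConstant.
Context {R : realType} {h : nat} {M : smooth_manifold R (2 * h + 2)}.
Local Notation chart_at i := (atlas (s := M) i).
Variables (alpha beta : local_form M 1).
Hypothesis hpair : generalized_contact_pair alpha beta.
Local Notation omega c :=
  (form_add (ext_d alpha) (form_scale c (form_wedge alpha beta))).

Let alpha_form : is_form alpha. Proof. by case: hpair. Qed.
Let beta_form : is_form beta. Proof. by case: hpair. Qed.
Let beta_closed : closed_form beta. Proof. by case: hpair. Qed.
Let dalpha_form : is_form (ext_d alpha). Proof. exact: is_form_ext_d. Qed.

Lemma contact_bordered_det i p : cdom (chart_at i) p ->
  \det (bordered_mx (ext_d alpha i (chart_map (chart_at i) p))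
    (alpha i (chart_map (chart_at i) p)) (beta i (chart_map (chart_at i) p)) 0) != 0.
Proof.
move=> pi.
have [_ _ _ /(_ i p pi) vol] := hpair.
have dimM : (1 + h * 2 + 1)%N = (2 * h + 2)%N by rewrite mulnC addnAC addnC.
have al := form_multilinear alpha_form pi.
have bl := form_multilinear beta_form pi.
have dl := form_multilinear dalpha_form pi.
apply: bordered_det_neq0 => //.
- exact: (form_alternating dalpha_form pi).
- exact: (contact_independent al bl dl dimM vol).
- exact: (contact_nondegenerate al bl dl dimM vol).
Qed.

(** The determinant of the bordered matrix with [t = c^-1] is a function of
    (q, c) whose limit as [q] tends to [p] and [c] to infinity is its value at
    [p] for [t = 0], which is nonzero. This gives nondegeneracy in a chart around
    [p], hence in every chart. *)
Lemma near_nondegenerate (p : M) :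
  \forall q \near p & c \near +oo, forall j, cdom (chart_at j) q ->
    nondegenerate_at (omega c) j (chart_map (chart_at j) q).
Proof.
have [i pi] := atlas_cover p.
pose B (z : M * R) := bordered_mx (ext_d alpha i (chart_map (chart_at i) z.1))
  (alpha i (chart_map (chart_at i) z.1))
  (beta i (chart_map (chart_at i) z.1)) z.2^-1.
pose FF := filter_prod (nbhs p) (@pinfty_nbhs R).
have cvg1 (g : M -> R) (l : R) :
    g q @[q --> p] --> l -> g z.1 @[z --> FF] --> l.
  by move=> gl; exact: (cvg_comp _ _ cvg_fst gl).
have Bcvg : \det (B z) @[z --> FF] --> \det (bordered_mx
    (ext_d alpha i (chart_map (chart_at i) p))
    (alpha i (chart_map (chart_at i) p))
    (beta i (chart_map (chart_at i) p)) 0).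
  apply: cvg_det; apply: cvg_bordered_mx.
  - move=> V; apply: (cvg1 (fun q => ext_d alpha i (chart_map (chart_at i) q) V)).
    exact: form_continuous.
  - move=> V; apply: (cvg1 (fun q => alpha i (chart_map (chart_at i) q) V)).
    exact: form_continuous.
  - move=> V; apply: (cvg1 (fun q => beta i (chart_map (chart_at i) q) V)).
    exact: form_continuous.
  - have inv0 : (c : R)^-1 @[c --> +oo] --> 0.
      by apply/gtr0_cvgV0 => //; exact: nbhs_pinfty_gt.
    exact: (cvg_comp _ _ cvg_snd inv0).
have Bdet : \forall z \near FF, \det (B z) != 0.
  exact: cvgr_neq0 Bcvg (contact_bordered_det pi).
have qi : \forall z \near FF, cdom (chart_at i) z.1.
  have qi : nbhs p (cdom (chart_at i)).
    by apply: open_nbhs_nbhs; split => //; exact: open_cdom.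
  exact: (cvg_fst qi).
have c_gt0 : \forall z \near FF, 0 < z.2.
  have c_gt0 : \forall c \near +oo, (0 : R) < c by exact: nbhs_pinfty_gt.
  exact: (cvg_snd c_gt0).
apply: filterS3 Bdet qi c_gt0 => -[q c] /= Bqc qi c0 j qj.
apply: (nondegenerate_change _ qi qj); first exact: is_form_omega.
move=> u uc; apply: (bordered_nondegenerate _ _ _ _ Bqc) => //.
- exact: (form_multilinear dalpha_form qi).
- exact: (form_multilinear alpha_form qi).
- exact: (form_multilinear beta_form qi).
- by rewrite gt_eqF.
- move=> v; rewrite -[RHS](uc v) /form_add /form_scale wedge11E.
  by rewrite row0_col_mx row1_col_mx.
Qed.

Lemma large_nondegenerate : closed_manifold M ->
  exists c0 : R, forall c, c0 <= c -> nondegenerate_form (omega c).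
Proof.
move=> /compact_near_coveringP cov.
have [c1 [_ c1P]] := cov R +oo _ _ (fun p _ => near_nondegenerate p).
exists (c1 + 1) => c c1c i p u pi.
apply: (c1P c _ p I i pi); apply: lt_le_trans c1c.
by rewrite ltrDl.
Qed.

End LargeConstant.

(** * Uniqueness of the Lee form *)

Section LeeUniqueness.
Context {R : realType} {n : nat} {M : smooth_manifold R n}.
Local Notation chart_at i := (atlas (s := M) i).
Variables (w : local_form M 2) (t e : local_form M 1).
Hypotheses (w_form : is_form w) (t_form : is_form t) (e_form : is_form e).

Lemma wedge21_col (b : local_form M 1) i p (u v z : 'rV[R]_n) :
  cdom (chart_at i) p ->
  let x := chart_map (chart_at i) p in
  form_wedge w b i x (col_mx u (col_mx v z) : 'M[R]_(3, n)) =
    w i x (col_mx u v) * b i x z - w i x (col_mx u z) * b i x v +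
    w i x (col_mx v z) * b i x u.
Proof.
move=> pi x.
pose V : 'M[R]_(1 + (1 + 1), n) := col_mx u (col_mx v z).
have V0 : row (0 : 'I_3) (V : 'M[R]_(3, n)) = u.
  transitivity (row (lshift (1 + 1) 0) V); first by congr row; exact/val_inj.
  by rewrite -row_usubmx col_mxKu row_id.
have V1 : row (1 : 'I_3) (V : 'M[R]_(3, n)) = v.
  transitivity (row (rshift 1 (0 : 'I_2)) V); first by congr row; exact/val_inj.
  by rewrite -row_dsubmx col_mxKd row0_col_mx.
have V2 : row (2 : 'I_3) (V : 'M[R]_(3, n)) = z.
  transitivity (row (rshift 1 (1 : 'I_2)) V); first by congr row; exact/val_inj.
  by rewrite -row_dsubmx col_mxKd row1_col_mx.
have := wedge21E b V (form_multilinear w_form pi) (form_alternating w_form pi).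
by rewrite V0 V1 V2.
Qed.

(** The difference of two Lee forms has zero wedge product with [w]. *)
Lemma lee_form_unique : (2 < n)%N -> nondegenerate_form w ->
  is_lee_form w t -> is_lee_form w e -> form_eq t e.
Proof.
move=> n2 nd [_ _ tw] [_ _ ew] i p v pi; set x := chart_map _ p.
have wl := form_multilinear w_form pi.
have tl := form_multilinear t_form pi.
have el := form_multilinear e_form pi.
apply/eqP; rewrite -subr_eq0; apply/eqP.
pose f (z : 'rV[R]_n) := t i x z + -1 * e i x z.
have fl : multilinear_rows f.
  by apply: multilinearD => //; exact: multilinearZ.
rewrite -[LHS]/(t i x v - e i x v) -mulN1r -/(f v).
apply: (wedge_injective wl fl n2 (fun u => nd i p u pi)) => u v' z.
have := ew i p (col_mx u (col_mx v' z) : 'M[R]_(3, n)) pi.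
rewrite (tw i p _ pi) !wedge21_col// /f => E.
by move/eqP: E; rewrite -subr_eq0 => /eqP E; rewrite -[RHS]E; ring.
Qed.

Lemma lee_form_congr : form_eq t e -> is_lee_form w e -> is_lee_form w t.
Proof.
move=> te [_ e_closed ew]; split => //.
- move=> i p V pi; rewrite -[RHS](e_closed i p V pi) !ext_d1E.
  have near_te u : \forall y \near chart_map (chart_at i) p, t i y u = e i y u.
    have : \forall y \near chart_map (chart_at i) p, coords i y.
      by apply: open_nbhs_nbhs; split; [exact: open_coords|exact: coords_map].
    by apply: filterS => _ [q qi <-]; exact: te.
  by rewrite !(near_eq_derive _ (near_te _)).
- move=> i p V pi; rewrite (ew i p V pi).
  by congr (_ * _); apply: eq_bigr => s _; rewrite -(te i p _ pi).
Qed.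

End LeeUniqueness.

Theorem proposition3p2 (R : realType) (h : nat)
  (M : smooth_manifold R (2 * h + 2)) (alpha beta : local_form M 1)
  (hdim : (4 <= 2 * h + 2)%N) (hM : closed_manifold M)
  (hpair : generalized_contact_pair alpha beta) :
  exists c0 : R, forall c : R, c0 <= c ->
    let omega := form_add (ext_d alpha) (form_scale c (form_wedge alpha beta)) in
    lcs_form omega /\
    (forall theta : local_form M 1, is_form theta ->
       (is_lee_form omega theta <-> form_eq theta (form_scale c beta))).
Proof.
have [alpha_form beta_form beta_closed _] := hpair.
have [c0 c0P] := large_nondegenerate hpair hM.
exists c0 => c c0c omega; have nd := c0P c c0c.
have omega_form : is_form omega by exact: is_form_omega.
have lee := is_lee_form_omega alpha_form beta_form beta_closed c.
split; first by split => //; exists (form_scale c beta).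
move=> theta theta_form; split.
- move=> theta_lee; apply: (lee_form_unique omega_form) theta_lee lee => //.
  + exact: is_form_scale.
  + exact: ltnW.
- by move=> theta_eq; exact: lee_form_congr theta_form theta_eq lee.
Qed.
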